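(* Let $(A,\{\!\!\{-,-\}\!\!\},\mathbf w)$ be a noncommutative Hamiltonian space. For every positive integer $N$ and every $\mathrm{GL}_N(\mathbb K)$-equivariant $\mathcal O$-module $\mathcal F$ on the representation space $\mathrm{Rep}^A_N$, the sheaf $\mathcal E_N\otimes_{\mathcal O}\mathcal F$ naturally carries a left $A\rtimes\mathcal G^A$-module structure; namely, the action in which $a\in A$ acts by left multiplication by the matrix-valued function $(a)$ and $\Theta\in\mathcal G^A$ acts entrywise by $(\Theta\cdot(f_{i,j}))_{u,v}=\big(\sum_{i=1}^N\Theta_{i,i}\big).f_{u,v}$ is a left $A\rtimes\mathcal G^A$-module structure.
   Context: $\mathbb K$ is an algebraically closed field of characteristic zero; algebras are finitely generated, associative, unital, not necessarily commutative; $\otimes=\otimes_{\mathbb K}$. **Double Poisson algebras.** A double Poisson bracket on a $\mathbb K$-algebra $A$ is a bilinear map $\{\!\!\{-,-\}\!\!\}:A\otimes A\to A\otimes A$, written $\{\!\!\{a,b\}\!\!\}=\{\!\!\{a,b\}\!\!\}'\otimes\{\!\!\{a,b\}\!\!\}''$, with (1) $\{\!\!\{a,b\}\!\!\}=-\{\!\!\{b,a\}\!\!\}''\otimes\{\!\!\{b,a\}\!\!\}'$; (2) $\{\!\!\{a,bc\}\!\!\}=\{\!\!\{a,b\}\!\!\}c+b\{\!\!\{a,c\}\!\!\}$ for the outer bimodule structure $a(x\otimes y)b=ax\otimes yb$; (3) $\{\!\!\{a,\{\!\!\{b,c\}\!\!\}\}\!\!\}_L+(132)\{\!\!\{c,\{\!\!\{a,b\}\!\!\}\}\!\!\}_L+(123)\{\!\!\{b,\{\!\!\{c,a\}\!\!\}\}\!\!\}_L=0$,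 where $\{\!\!\{a,b_1\otimes b_2\}\!\!\}_L=\{\!\!\{a,b_1\}\!\!\}\otimes b_2$ and $\sigma\in\mathcal S_3$ acts by $\sigma(v_1\otimes v_2\otimes v_3)=v_{\sigma^{-1}(1)}\otimes v_{\sigma^{-1}(2)}\otimes v_{\sigma^{-1}(3)}$. A noncommutative moment map is $\mathbf w\in A$ with $\{\!\!\{\mathbf w,p\}\!\!\}=p\otimes1-1\otimes p$ for all $p\in A$. A noncommutative Hamiltonian space is a double Poisson algebra with a noncommutative moment map. **Double derivations and gauge group.** $\mathbb D\mathrm{er}(A)$ is the space of derivations $\Theta:A\to A\otimes A$ (outer structure on the target), $\Theta(a)=\Theta'(a)\otimes\Theta''(a)$. It is an $A$-bimodule through the inner structure: $(p\Theta q)(a)=\Theta'(a)q\otimes p\,\Theta''(a)$. The gauge element is $E=\{\!\!\{\mathbf w,-\}\!\!\}$, i.e. $E(a)=a\otimes1-1\otimes a$. The noncommutative gauge group $\mathcal G^A$ is the $A$-bimodule generated by $E$. **Schouten bracket.** For $\Theta\in\mathbb D\mathrm{er}(A)$, $a\in A$: $\{\Theta,a\}_{\mathrm{SN}}=\Theta'(a)\Theta''(a)\in A$. For $\delta,\Delta\in\mathbb D\mathrm{er}(A)$ (Van den Bergh), put $\{\!\!\{\delta,\Delta\}\!\!\}_l=\tau_{(23)}\circ\big((\delta\otimes1)\Delta-(1\otimes\Delta)\delta\big)$, regarded as an element of $\mathbb D\mathrm{er}(A)\otimes A$ (first two tensor factors of the value form the double derivation), and $\{\!\!\{\delta,\Delta\}\!\!\}_r=\tau_{(12)}\circ\big((1\otimes\delta)\Delta-(\Delta\otimes1)\delta\big)$,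 regarded as an element of $A\otimes\mathbb D\mathrm{er}(A)$ (last two tensor factors form the double derivation), where $\tau_{(ij)}$ swaps tensor factors $i$ and $j$. Then $\{\!\!\{\delta,\Delta\}\!\!\}_{\mathrm{SN}}=\{\!\!\{\delta,\Delta\}\!\!\}_l+\{\!\!\{\delta,\Delta\}\!\!\}_r$, and $\{\delta,\Delta\}_{\mathrm{SN}}\in\mathbb D\mathrm{er}(A)$ is obtained by multiplying the two tensor factors using the bimodule structure of $\mathbb D\mathrm{er}(A)$. **Semidirect product algebra.** $A\rtimes\mathcal G^A$ is the quotient of the free product $A\cdot\mathcal G^A$ (the algebra freely generated by $A$ and $\mathcal G^A$) by the relations: (1) $\Theta_1\cdot\Theta_2-\Theta_2\cdot\Theta_1=\{\Theta_1,\Theta_2\}_{\mathrm{SN}}$ for $\Theta_1,\Theta_2\in\mathcal G^A$; (2) $a_1\cdot a_2=a_1a_2$ for $a_1,a_2\in A$; (3) $\Theta\cdot a-a\cdot\Theta=\{\Theta,a\}_{\mathrm{SN}}$ for $\Theta\in\mathcal G^A$, $a\in A$. **Representation space.** $\mathrm{Rep}^A_N=\mathrm{Hom}_{\mathrm{Alg}}(A,\mathfrak{gl}_N(\mathbb K))$ with structure sheaf $\mathcal O$; $\mathrm{GL}_N(\mathbb K)$ acts by $(g.\rho)(a)=g\rho(a)g^{-1}$. Each $a\in A$ gives a matrix of functions $(a)=(a_{p,q})$, $a_{p,q}(\rho)=\rho(a)_{p,q}$. $\mathcal E_N$ is the sheaf of sections of the tautological bundle with fibre $\mathfrak{gl}(\mathbb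 K^N)$, i.e. $N\times N$ matrices with entries in $\mathcal O$; so sections of $\mathcal E_N\otimes_{\mathcal O}\mathcal F$ are $N\times N$ matrices $(f_{i,j})$ with entries in $\mathcal F$. **Action of $\Theta_{i,i}$.** A double derivation $\Theta$ induces derivations $\Theta_{i,j}$ of $\mathbb K[\mathrm{Rep}^A_N]$ by $\Theta_{i,j}(a_{u,v})=(\Theta'(a))_{u,j}(\Theta''(a))_{i,v}$; in particular $E_{p,q}$ is the derivation by which the elementary matrix $e_{q,p}\in\mathfrak{gl}_N(\mathbb K)$ acts on functions. The equivariant structure on $\mathcal F$ induces a Lie algebra map $\kappa:\mathfrak{gl}_N(\mathbb K)\to\mathrm{End}_{\mathbb K}(\mathcal F)$ with $\kappa(\gamma)(hf)=\gamma(h)f+h\kappa(\gamma)(f)$ for $h\in\mathcal O$, $f\in\mathcal F$. The action of $\Theta_{i,i}$ on $\mathcal F$ is given by $\kappa$, extended $\mathcal O$-linearly: $E_{l,k}$ acts as $\kappa(e_{k,l})$, and for $\Theta=\sum_\alpha p_\alpha E q_\alpha$, $\Theta_{i,i}.f=\sum_{\alpha,k,l}(p_\alpha)_{i,l}(q_\alpha)_{k,i}\,\kappa(e_{k,l})f$.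
   Formalization: The action formula can depend on how Θ is written as Σ pEq (A = K: E = 0, yet 1E1 acts by κ(1)); so it is proved for the A-bimodule freely generated by E, and for the sub-bimodule of double derivations exactly when the formula is independent of the presentation. *)

(* Defs.v *)
From HB Require Import structures.
From mathcomp Require Import all_boot all_order all_algebra all_classical.

Set Implicit Arguments.
Unset Strict Implicit.
Unset Printing Implicit Defensive.

Import GRing.Theory.
Local Open Scope quotient_scope.
Local Open Scope classical_set_scope.
Local Open Scope ring_scope.

(* Tensor products.  [tens U V] is the quotient of the lists of pairs (u, v),  *)
(* read as formal sums of the u (x) v, by the equality of the sums under all   *)
(* bilinear maps.                                                              *)

Section Tensor.
Variables (K : fieldType) (U V : lmodType K).

Definition bilin (W : lmodType K) (b : U -> V -> W) :=
  (forall v, linear (fun u => b u v)) /\ (forall u, linear (b u)).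

Definition tsum (W : lmodType K) (b : U -> V -> W) (s : seq (U * V)) : W :=
  \sum_(p <- s) b p.1 p.2.

Definition tens_rel (s t : seq (U * V)) : bool :=
  `[< forall (W : lmodType K) (b : U -> V -> W), bilin b -> tsum b s = tsum b t >].

Lemma tens_relP s t :
  reflect (forall (W : lmodType K) (b : U -> V -> W),
             bilin b -> tsum b s = tsum b t)
          (tens_rel s t).
Proof. exact: asboolP. Qed.

Lemma tens_rel_equiv : equiv_class_of tens_rel.
Proof.
split=> [s|s t|t s r]; first exact/tens_relP.
- by apply/tens_relP/tens_relP => h W b hb; rewrite h.
- move=> /tens_relP h1 /tens_relP h2; apply/tens_relP => W b hb.
  by rewrite h1 // h2.
Qed.

Canonical tens_equiv := EquivRelPack tens_rel_equiv.

Definition tens := {eq_quot tens_rel}.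
HB.instance Definition _ := Choice.on tens.
HB.instance Definition _ := EqQuotient.on tens.

(* The linear map induced by b, when b is bilinear. *)
Definition tlift (W : lmodType K) (b : U -> V -> W) (t : tens) : W :=
  tsum b (repr t).

Definition tensor (u : U) (v : V) : tens := \pi_tens [:: (u, v)].

Definition tadd (x y : tens) : tens := \pi_tens (repr x ++ repr y).
Definition tscale (c : K) (x : tens) : tens :=
  \pi_tens [seq (c *: p.1, p.2) | p <- repr x].
Definition topp (x : tens) : tens := tscale (-1) x.
Definition tzero : tens := \pi_tens [::].

Lemma tlift_pi (W : lmodType K) (b : U -> V -> W) s :
  bilin b -> tlift b (\pi_tens s) = tsum b s.
Proof.
move=> hb; rewrite /tlift; apply: (tens_relP _ _ _) => //.
by have /eqquotP := reprK (\pi_tens s).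
Qed.

Lemma tens_ext (x y : tens) :
  (forall (W : lmodType K) (b : U -> V -> W), bilin b -> tlift b x = tlift b y) ->
  x = y.
Proof.
by move=> h; rewrite -[x]reprK -[y]reprK; apply/eqquotP/tens_relP => W b /h.
Qed.

Lemma bilin_0l (W : lmodType K) (b : U -> V -> W) v : bilin b -> b 0 v = 0.
Proof. by case=> h _; have := h v (-1) 0 0; rewrite scaler0 addr0 scaleN1r addNr. Qed.
Lemma bilin_0r (W : lmodType K) (b : U -> V -> W) u : bilin b -> b u 0 = 0.
Proof. by case=> _ h; have := h u (-1) 0 0; rewrite scaler0 addr0 scaleN1r addNr. Qed.
Lemma bilin_Zl (W : lmodType K) (b : U -> V -> W) c u v :
  bilin b -> b (c *: u) v = c *: b u v.
Proof. by move=> hb; have := hb.1 v c u 0; rewrite addr0 bilin_0l // addr0. Qed.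

Lemma tlift_add (W : lmodType K) (b : U -> V -> W) x y :
  bilin b -> tlift b (tadd x y) = tlift b x + tlift b y.
Proof. by move=> hb; rewrite tlift_pi // /tsum big_cat. Qed.

Lemma tlift_scale (W : lmodType K) (b : U -> V -> W) c x :
  bilin b -> tlift b (tscale c x) = c *: tlift b x.
Proof.
move=> hb; rewrite tlift_pi // /tsum big_map /tlift /tsum scaler_sumr.
by apply: eq_bigr => p _; rewrite bilin_Zl.
Qed.

Lemma tlift_zero (W : lmodType K) (b : U -> V -> W) :
  bilin b -> tlift b tzero = 0.
Proof. by move=> hb; rewrite tlift_pi // /tsum big_nil. Qed.

Lemma taddA : associative tadd.
Proof. by move=> x y z; apply: tens_ext => W b hb; rewrite !tlift_add // addrA. Qed.
Lemma taddC : commutative tadd.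
Proof. by move=> x y; apply: tens_ext => W b hb; rewrite !tlift_add // addrC. Qed.
Lemma tadd0 : left_id tzero tadd.
Proof.
by move=> x; apply: tens_ext => W b hb; rewrite tlift_add // tlift_zero // add0r.
Qed.
Lemma taddN : left_inverse tzero topp tadd.
Proof.
move=> x; apply: tens_ext => W b hb.
by rewrite tlift_add // tlift_scale // tlift_zero // scaleN1r addNr.
Qed.

HB.instance Definition _ := GRing.isZmodule.Build tens taddA taddC tadd0 taddN.

Lemma tscaleA c d x : tscale c (tscale d x) = tscale (c * d) x.
Proof. by apply: tens_ext => W b hb; rewrite !tlift_scale // scalerA. Qed.
Lemma tscale1 : left_id 1 tscale.
Proof. by move=> x; apply: tens_ext => W b hb; rewrite tlift_scale // scale1r. Qed.
Lemma tscaleDr : right_distributive tscale +%R.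
Proof.
by move=> c x y; apply: tens_ext => W b hb;
   rewrite !(tlift_add, tlift_scale) // scalerDr.
Qed.
Lemma tscaleDl x : {morph tscale^~ x : c d / c + d}.
Proof.
by move=> c d; apply: tens_ext => W b hb;
   rewrite !(tlift_add, tlift_scale) // scalerDl.
Qed.

HB.instance Definition _ := GRing.Zmodule_isLmodule.Build K tens
  tscaleA tscale1 tscaleDr tscaleDl.

Lemma tlift_linear (W : lmodType K) (b : U -> V -> W) : bilin b -> linear (tlift b).
Proof. by move=> hb c x y; rewrite tlift_add // tlift_scale. Qed.

Lemma tlift_tensor (W : lmodType K) (b : U -> V -> W) u v :
  bilin b -> tlift b (tensor u v) = b u v.
Proof. by move=> hb; rewrite tlift_pi // /tsum big_seq1. Qed.

Lemma tensor_bilin : bilin tensor.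
Proof.
split=> [v c x y|u c x y]; apply: tens_ext => W b hb;
  by rewrite tlift_linear // !tlift_tensor // (hb.1, hb.2).
Qed.

Lemma tens_sum (x : tens) : x = \sum_(p <- repr x) tensor p.1 p.2.
Proof.
apply: tens_ext => W b hb.
have h := tlift_linear hb.
have h0 : tlift b 0 = 0 by apply: tlift_zero.
have hD y z : tlift b (y + z) = tlift b y + tlift b z by apply: tlift_add.
rewrite (big_morph _ hD h0) {1}/tlift /tsum.
by apply: eq_bigr => p _; rewrite tlift_tensor.
Qed.

End Tensor.

Arguments tens {K} U V.
Notation "u ⊗ v" := (tensor u v) (at level 40, left associativity).

Section Algebra.
Variables (K : fieldType) (A : algType K).

Definition subalgebra (S : A -> Prop) :=
  [/\ S 1, forall x y, S x -> S y -> S (x * y)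
    & forall (c : K) x y, S x -> S y -> S (c *: x + y)].

Definition finitely_generated :=
  exists s : seq A, forall S : A -> Prop,
    subalgebra S -> (forall x, x \in s -> S x) -> forall x, S x.

Local Notation AA := (tens A A).
Local Notation AAA := (tens (tens A A) A).

Definition tmap (U V U' V' : lmodType K) (f : U -> U') (g : V -> V')
  : tens U V -> tens U' V' := tlift (fun u v => f u ⊗ g v).

Definition tswap : AA -> AA := tlift (fun x y => y ⊗ x).
Definition tmul : AA -> A := tlift (fun x y => x * y).

(* outer bimodule structure a(x (x) y)b = ax (x) yb *)
Definition outl (a : A) : AA -> AA := tmap (fun x => a * x) idfun.
Definition outr (t : AA) (b : A) : AA := tmap idfun (fun y => y * b) t.

Definition tlift3 (W : lmodType K) (b : A -> A -> A -> W) : AAA -> W :=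
  tlift (fun xy z => tlift (fun x y => b x y z) xy).

(* sigma(v1 (x) v2 (x) v3) = v_(sigma^-1 1) (x) v_(sigma^-1 2) (x) v_(sigma^-1 3) *)
Definition perm123 : AAA -> AAA := tlift3 (fun x y z => z ⊗ x ⊗ y).
Definition perm132 : AAA -> AAA := tlift3 (fun x y z => y ⊗ z ⊗ x).
Definition perm12 : AAA -> AAA := tlift3 (fun x y z => y ⊗ x ⊗ z).
Definition perm23 : AAA -> AAA := tlift3 (fun x y z => x ⊗ z ⊗ y).

(* d (x) 1 and 1 (x) d on A (x) A *)
Definition dleft (d : A -> AA) : AA -> AAA := tmap d idfun.
Definition dright (d : A -> AA) : AA -> AAA :=
  tlift (fun x y => tlift (fun y1 y2 => x ⊗ y1 ⊗ y2) (d y)).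

Record double_poisson := DoublePoisson {
  dbr :> A -> A -> AA;
  dbr_bilin : bilin dbr;
  dbr_antisym : forall a b, dbr a b = - tswap (dbr b a);
  dbr_leibniz : forall a b c, dbr a (b * c) = outr (dbr a b) c + outl b (dbr a c);
  dbr_jacobi : forall a b c,
    dleft (dbr a) (dbr b c) + perm132 (dleft (dbr c) (dbr a b))
      + perm123 (dleft (dbr b) (dbr c a)) = 0
}.

Definition moment_map (P : double_poisson) (w : A) :=
  forall p, P w p = p ⊗ 1 - 1 ⊗ p.

Record hamiltonian_space := HamiltonianSpace {
  hs_bracket : double_poisson;
  hs_moment : A;
  hs_momentP : moment_map hs_bracket hs_moment
}.

Definition double_derivation (T : A -> AA) :=
  linear T /\ forall a b, T (a * b) = outr (T a) b + outl a (T b).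

(* (p T q)(a) = T'(a) q (x) p T''(a) *)
Definition bimod (p : A) (T : A -> AA) (q : A) : A -> AA :=
  fun a => tmap (fun x => x * q) (fun y => p * y) (T a).

Definition sn_act (T : A -> AA) (a : A) : A := tmul (T a).

Definition sn_l (d D : A -> AA) (a : A) : AAA :=
  perm23 (dleft d (D a) - dright D (d a)).
Definition sn_r (d D : A -> AA) (a : A) : AAA :=
  perm12 (dright d (D a) - dleft D (d a)).

(* In sn_l the value at a of T (x) b is T'(a) (x) T''(a) (x) b, and the value *)
(* of T b is T'(a) b (x) T''(a).  In sn_r the value of b (x) T is             *)
(* b (x) T'(a) (x) T''(a), and that of b T is T'(a) (x) b T''(a).             *)
Definition sn_bracket (d D : A -> AA) (a : A) : AA :=
  tlift3 (fun x y b => (x * b) ⊗ y) (sn_l d D a)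
  + tlift3 (fun b x y => x ⊗ (b * y)) (sn_r d D a).

Lemma tens_ind (U V : lmodType K) (P : tens U V -> Prop) :
  P 0 -> (forall x y, P x -> P y -> P (x + y)) -> (forall u v, P (u ⊗ v)) ->
  forall t, P t.
Proof.
move=> P0 PD Pt t; rewrite (tens_sum t).
by apply: (big_ind P) => // p _; exact: Pt.
Qed.

Lemma tliftD (U V W : lmodType K) (b : U -> V -> W) : bilin b ->
  forall x y, tlift b (x + y) = tlift b x + tlift b y.
Proof. by move=> hb x y; exact: tlift_add. Qed.
Lemma tlift0 (U V W : lmodType K) (b : U -> V -> W) : bilin b -> tlift b 0 = 0.
Proof. by move=> hb; exact: tlift_zero. Qed.
Lemma tliftN (U V W : lmodType K) (b : U -> V -> W) : bilin b ->
  forall x, tlift b (- x) = - tlift b x.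
Proof.
move=> hb x; apply: (addrI (tlift b x)).
by rewrite -tliftD // !subrr tlift0.
Qed.

Lemma tensorDl (U V : lmodType K) (x y : U) (v : V) : (x + y) ⊗ v = x ⊗ v + y ⊗ v.
Proof. by have := (tensor_bilin U V).1 v 1 x y; rewrite !scale1r. Qed.
Lemma tensorDr (U V : lmodType K) (u : U) (x y : V) : u ⊗ (x + y) = u ⊗ x + u ⊗ y.
Proof. by have := (tensor_bilin U V).2 u 1 x y; rewrite !scale1r. Qed.
Lemma tensorNl (U V : lmodType K) (x : U) (v : V) : (- x) ⊗ v = - (x ⊗ v).
Proof.
have := (tensor_bilin U V).1 v (-1) x 0.
by rewrite (bilin_0l _ (tensor_bilin U V)) !addr0 !scaleN1r.
Qed.
Lemma tensorNr (U V : lmodType K) (u : U) (x : V) : u ⊗ (- x) = - (u ⊗ x).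
Proof.
have := (tensor_bilin U V).2 u (-1) x 0.
by rewrite (bilin_0r _ (tensor_bilin U V)) !addr0 !scaleN1r.
Qed.

Lemma bilin_map (U V U' V' : lmodType K) (f : U -> U') (g : V -> V') :
  linear f -> linear g -> bilin (fun u v => f u ⊗ g v).
Proof.
move=> hf hg; split=> [v c x y|u c x y].
  by rewrite hf (tensor_bilin _ _).1.
by rewrite hg (tensor_bilin _ _).2.
Qed.

Lemma tmapE (U V U' V' : lmodType K) (f : U -> U') (g : V -> V') u v :
  linear f -> linear g -> tmap f g (u ⊗ v) = f u ⊗ g v.
Proof. by move=> hf hg; rewrite /tmap tlift_tensor //; exact: bilin_map. Qed.

Lemma tmapD (U V U' V' : lmodType K) (f : U -> U') (g : V -> V') :
  linear f -> linear g -> forall x y, tmap f g (x + y) = tmap f g x + tmap f g y.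
Proof. by move=> hf hg; apply: tliftD; exact: bilin_map. Qed.
Lemma tmapN (U V U' V' : lmodType K) (f : U -> U') (g : V -> V') :
  linear f -> linear g -> forall x, tmap f g (- x) = - tmap f g x.
Proof. by move=> hf hg; apply: tliftN; exact: bilin_map. Qed.
Lemma tmap0 (U V U' V' : lmodType K) (f : U -> U') (g : V -> V') :
  linear f -> linear g -> tmap f g 0 = 0.
Proof. by move=> hf hg; apply: tlift0; exact: bilin_map. Qed.
Lemma tmap_linear (U V U' V' : lmodType K) (f : U -> U') (g : V -> V') :
  linear f -> linear g -> linear (tmap f g).
Proof. by move=> hf hg; apply: tlift_linear; exact: bilin_map. Qed.

Lemma linear_mull (p : A) : linear (fun x => p * x).
Proof. by move=> c x y; rewrite mulrDr -scalerAr. Qed.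
Lemma linear_mulr (q : A) : linear (fun x => x * q).
Proof. by move=> c x y; rewrite mulrDl -scalerAl. Qed.
Lemma linear_idfun (V : lmodType K) : linear (@idfun V).
Proof. by []. Qed.

Lemma outrE x y b : outr (x ⊗ y) b = x ⊗ (y * b).
Proof. by rewrite /outr tmapE //; exact: linear_mulr. Qed.
Lemma outrD s t b : outr (s + t) b = outr s b + outr t b.
Proof. by rewrite /outr tmapD //; exact: linear_mulr. Qed.
Lemma outrN s b : outr (- s) b = - outr s b.
Proof. by rewrite /outr tmapN //; exact: linear_mulr. Qed.
Lemma outr0 b : outr 0 b = 0.
Proof. by rewrite /outr tmap0 //; exact: linear_mulr. Qed.
Lemma outlE a x y : outl a (x ⊗ y) = (a * x) ⊗ y.
Proof. by rewrite /outl tmapE //; exact: linear_mull. Qed.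
Lemma outlD a s t : outl a (s + t) = outl a s + outl a t.
Proof. by rewrite /outl tmapD //; exact: linear_mull. Qed.
Lemma outlN a s : outl a (- s) = - outl a s.
Proof. by rewrite /outl tmapN //; exact: linear_mull. Qed.
Lemma outl0 a : outl a 0 = 0.
Proof. by rewrite /outl tmap0 //; exact: linear_mull. Qed.

Definition trilin (W : lmodType K) (b : A -> A -> A -> W) :=
  [/\ forall y z, linear (fun x => b x y z), forall x z, linear (fun y => b x y z)
    & forall x y, linear (b x y)].

Lemma tlift_linearf (U V W : lmodType K) (b b' b'' : U -> V -> W) (c : K) :
  (forall u v, b u v = c *: b' u v + b'' u v) ->
  forall t, tlift b t = c *: tlift b' t + tlift b'' t.
Proof.
move=> h t; rewrite /tlift /tsum scaler_sumr -big_split.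
by apply: eq_bigr => p _; rewrite h.
Qed.

Lemma trilin_bilin (W : lmodType K) (b : A -> A -> A -> W) : trilin b ->
  bilin (fun xy z => tlift (fun x y => b x y z) xy).
Proof.
case=> h1 h2 h3; split=> [z|t c z z'].
  by apply: tlift_linear; split=> [y|x]; [exact: h1|exact: h2].
by apply: tlift_linearf => x y; exact: h3.
Qed.

Lemma tlift3E (W : lmodType K) (b : A -> A -> A -> W) x y z : trilin b ->
  tlift3 b (x ⊗ y ⊗ z) = b x y z.
Proof.
move=> hb; rewrite /tlift3 tlift_tensor; last exact: trilin_bilin.
by case: hb => h1 h2 _; rewrite tlift_tensor.
Qed.
Lemma tlift3D (W : lmodType K) (b : A -> A -> A -> W) : trilin b ->
  forall s t, tlift3 b (s + t) = tlift3 b s + tlift3 b t.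
Proof. by move=> hb; apply: tliftD; exact: trilin_bilin. Qed.
Lemma tlift3N (W : lmodType K) (b : A -> A -> A -> W) : trilin b ->
  forall s, tlift3 b (- s) = - tlift3 b s.
Proof. by move=> hb; apply: tliftN; exact: trilin_bilin. Qed.

Lemma trilin_tensor (f1 f2 f3 : A -> A -> A -> A) :
  (forall (W : lmodType K) (b : A -> A -> A -> W), trilin b ->
     trilin (fun x y z => b (f1 x y z) (f2 x y z) (f3 x y z))) ->
  trilin (fun x y z => f1 x y z ⊗ f2 x y z ⊗ f3 x y z).
Proof.
move=> h; apply: (h _ (fun x y z => x ⊗ y ⊗ z)).
have T2 := tensor_bilin A A; have T3 := tensor_bilin AA A.
split=> [y z c u v|x z c u v|x y c u v]; last by rewrite T3.2.
  by rewrite T2.1 T3.1.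
by rewrite T2.2 T3.1.
Qed.

Lemma trilin23 : trilin (fun x y z : A => x ⊗ z ⊗ y).
Proof. by apply: trilin_tensor => W b []; split. Qed.
Lemma trilin12 : trilin (fun x y z : A => y ⊗ x ⊗ z).
Proof. by apply: trilin_tensor => W b []; split. Qed.
Lemma trilin_id : trilin (fun x y z : A => x ⊗ y ⊗ z).
Proof. by apply: trilin_tensor => W b []; split. Qed.

Lemma trilin_cl : trilin (fun x y b : A => (x * b) ⊗ y).
Proof.
have T2 := tensor_bilin A A.
split=> [y z c u v|x z c u v|x y c u v]; last by rewrite linear_mull T2.1.
  by rewrite linear_mulr T2.1.
by rewrite T2.2.
Qed.
Lemma trilin_cr : trilin (fun b x y : A => x ⊗ (b * y)).
Proof.
have T2 := tensor_bilin A A.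
split=> [y z c u v|x z c u v|x y c u v]; last by rewrite linear_mull T2.2.
  by rewrite linear_mulr T2.2.
by rewrite T2.1.
Qed.

Lemma assoc3_bilin (x : A) : bilin (fun y1 y2 : A => x ⊗ y1 ⊗ y2).
Proof. by case: trilin_id => h1 h2 h3; split. Qed.

Lemma dright_bilin (d : A -> AA) : linear d ->
  bilin (fun x y : A => tlift (fun y1 y2 => x ⊗ y1 ⊗ y2) (d y)).
Proof.
move=> hd; split=> [y c u v|x c u v].
  by apply: tlift_linearf => y1 y2; case: trilin_id => h _ _; exact: h.
by rewrite hd tlift_linear //; exact: assoc3_bilin.
Qed.

End Algebra.

Section Gauge.
Variables (K : fieldType) (A : algType K) (H : hamiltonian_space A).
Local Notation AA := (tens A A).

Definition gaugeE : A -> AA := hs_bracket H (hs_moment H).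
Definition pEq (p q : A) : A -> AA := bimod p gaugeE q.

Definition pEq_sum (s : seq (A * A)) : A -> AA :=
  fun a => \sum_(pq <- s) pEq pq.1 pq.2 a.

(* The sub-bimodule of the double derivations generated by E. *)
Definition gauge_pred : {pred A -> AA} := fun T => `[< exists s, T = pEq_sum s >].

Lemma gaugeE_val a : gaugeE a = a ⊗ 1 - 1 ⊗ a.
Proof. exact: hs_momentP. Qed.

Lemma pEqE p q a : pEq p q a = (a * q) ⊗ p - q ⊗ (p * a).
Proof.
have hl := linear_mull p; have hr := linear_mulr q.
by rewrite /pEq /bimod gaugeE_val tmapD // tmapN // !tmapE // !mul1r mulr1.
Qed.

Lemma pEq_linear p q : linear (pEq p q).
Proof.
move=> c x y; rewrite !pEqE.
have [T1 T2] := tensor_bilin A A.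
rewrite (linear_mulr q) T1 (linear_mull p) T2.
by rewrite scalerBr opprD addrACA.
Qed.

Lemma pEq_bilin a : bilin (fun p q => pEq p q a).
Proof.
have [T1 T2] := tensor_bilin A A.
split=> [q c x y|p c x y]; rewrite !pEqE.
  by rewrite (linear_mulr a) !T2 scalerBr opprD addrACA.
by rewrite (linear_mull a) !T1 scalerBr opprD addrACA.
Qed.

Lemma pEq_der p q : double_derivation (pEq p q).
Proof.
split=> [|a b]; first exact: pEq_linear.
rewrite !pEqE outrD outrN outlD outlN !outrE !outlE !mulrA.
by rewrite [RHS]addrC addrA subrK.
Qed.

Lemma pEq_sum_der s : double_derivation (pEq_sum s).
Proof.
split=> [c x y|a b]; rewrite /pEq_sum.
  rewrite scaler_sumr -big_split; apply: eq_bigr => i _; exact: pEq_linear.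
rewrite (big_morph (fun t => outr t b) (fun x y => @outrD K A x y b) (@outr0 K A b)).
rewrite (big_morph (outl a) (@outlD K A a) (@outl0 K A a)) -big_split.
by apply: eq_bigr => i _; rewrite (pEq_der _ _).2.
Qed.

Lemma gauge_pred_closed : submod_closed gauge_pred.
Proof.
split=> [|c T T' /asboolP[s ->] /asboolP[t ->]].
  by apply/asboolP; exists [::]; apply/funext => a; rewrite /pEq_sum big_nil.
apply/asboolP; exists ([seq (c *: p.1, p.2) | p <- s] ++ t).
apply/funext => a; rewrite /pEq_sum big_cat big_map /=.
congr (_ + _); rewrite -[LHS]/(c *: \sum_(pq <- s) pEq pq.1 pq.2 a) scaler_sumr.
by apply: eq_bigr => p _; rewrite (bilin_Zl _ _ _ (pEq_bilin a)).
Qed.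

HB.instance Definition _ :=
  GRing.isSubmodClosed.Build K (A -> AA) gauge_pred gauge_pred_closed.

Record gauge := Gauge { gauge_val :> A -> AA; _ : gauge_val \in gauge_pred }.

HB.instance Definition _ := [isSub for gauge_val].
HB.instance Definition _ := [Choice of gauge by <:].
HB.instance Definition _ := [SubChoice_isSubLmodule of gauge by <:].

Lemma gauge_presented (T : gauge) : exists s, gauge_val T = pEq_sum s.
Proof. by case: T => T /= hT; apply/asboolP. Qed.

Lemma gauge_der (T : gauge) : double_derivation T.
Proof. by have [s ->] := gauge_presented T; exact: pEq_sum_der. Qed.

(* The free A-bimodule A (x) A on E, with p (x) q standing for pEq, and its  *)
(* map to the double derivations. *)
Definition anchor (P : AA) : A -> AA := fun a => tlift (fun p q => pEq p q a) P.

(* The bracket of free presentations obtained from                            *)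
(*   {{pEq, rEs}}_l = rEsq (x) p - rEq (x) ps + rpEq (x) s,                    *)
(*   {{pEq, rEs}}_r = rq (x) pEs - q (x) prEs - r (x) pEqs                     *)
(* by multiplying the two factors; it lifts the Schouten bracket, see          *)
(* [sn_bracket_anchor].                                                        *)
Definition free_bracket (P Q : AA) : AA :=
  tlift (fun p q => tlift (fun r s =>
    r ⊗ (s * q * p) - r ⊗ (q * p * s) + (r * q * p) ⊗ s - (q * p * r) ⊗ s) Q) P.


Lemma anchorE p q : anchor (p ⊗ q) = pEq p q.
Proof. by apply/funext => a; rewrite /anchor tlift_tensor //; exact: pEq_bilin. Qed.

Lemma anchorD P Q a : anchor (P + Q) a = anchor P a + anchor Q a.
Proof. by rewrite /anchor tliftD //; exact: pEq_bilin. Qed.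

Lemma anchor0 a : anchor 0 a = 0.
Proof. by rewrite /anchor tlift0 //; exact: pEq_bilin. Qed.

Lemma anchorN P a : anchor (- P) a = - anchor P a.
Proof. by rewrite /anchor tliftN //; exact: pEq_bilin. Qed.

Lemma anchor_linear P : linear (anchor P).
Proof. by move=> c x y; apply: tlift_linearf => p q; exact: pEq_linear. Qed.

Definition free_br_val (m r s : A) : AA :=
  r ⊗ (s * m) - r ⊗ (m * s) + (r * m) ⊗ s - (m * r) ⊗ s.

Lemma free_br_val_linear r s : linear (fun m => free_br_val m r s).
Proof.
have [T1 T2] := tensor_bilin A A => c x y; rewrite /free_br_val.
rewrite (linear_mull s) (linear_mulr s) (linear_mull r) (linear_mulr r) !T1 !T2.
rewrite !(scalerBr, scalerDr) !opprD.
set a := _ *: _; set b := _ *: _; set d := _ *: _; set e := _ *: _.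
by rewrite !addrA [LHS](ACl (1*3*5*7*2*4*6*8)).
Qed.


Lemma free_br_val_bilin m : bilin (fun r s => free_br_val m r s).
Proof.
have [T1 T2] := tensor_bilin A A.
split=> [v c x y|u c x y]; rewrite /free_br_val.
  rewrite (linear_mulr m) (linear_mull m) !T1.
  by rewrite !(scalerBr, scalerDr) !opprD !addrA [LHS](ACl (1*3*5*7*2*4*6*8)).
rewrite (linear_mulr m) (linear_mull m) !T2.
by rewrite !(scalerBr, scalerDr) !opprD !addrA [LHS](ACl (1*3*5*7*2*4*6*8)).
Qed.

Lemma free_br_fun p q : (fun r s : A => r ⊗ (s * q * p) - r ⊗ (q * p * s)
  + (r * q * p) ⊗ s - (q * p * r) ⊗ s) = free_br_val (q * p).
Proof.
by apply/funext => r'; apply/funext => s'; rewrite /free_br_val !mulrA.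
Qed.

Lemma free_bracket_bilin Q : bilin (fun p q : A => tlift (fun r s : A =>
  r ⊗ (s * q * p) - r ⊗ (q * p * s) + (r * q * p) ⊗ s - (q * p * r) ⊗ s) Q).
Proof.
split=> [v c x y|u c x y]; apply: tlift_linearf => r' s';
  have := free_br_val_linear r' s'; rewrite /free_br_val => h.
  by have := h c (v * x) (v * y); rewrite -(linear_mull v) !mulrA.
by have := h c (x * u) (y * u); rewrite -(linear_mulr u) !mulrA.
Qed.

Lemma free_bracketE p q r s :
  free_bracket (p ⊗ q) (r ⊗ s) = free_br_val (q * p) r s.
Proof.
rewrite /free_bracket tlift_tensor; last exact: free_bracket_bilin.
by rewrite free_br_fun tlift_tensor //; exact: free_br_val_bilin.
Qed.

Lemma dleftE (d : A -> AA) x y : linear d -> dleft d (x ⊗ y) = d x ⊗ y.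
Proof. by move=> hd; rewrite /dleft tmapE. Qed.
Lemma dleftB (d : A -> AA) t u : linear d -> dleft d (t - u) = dleft d t - dleft d u.
Proof. by move=> hd; rewrite /dleft tmapD // tmapN. Qed.

Lemma drightB (d : A -> AA) t u : linear d ->
  dright d (t - u) = dright d t - dright d u.
Proof.
by move=> hd; rewrite /dright tliftD ?tliftN //; exact: dright_bilin.
Qed.

Lemma dleft_pEq p q x y :
  dleft (pEq p q) (x ⊗ y) = (x * q) ⊗ p ⊗ y - q ⊗ (p * x) ⊗ y.
Proof. by rewrite dleftE ?pEqE ?tensorDl ?tensorNl //; exact: pEq_linear. Qed.

Lemma dright_pEq p q x y :
  dright (pEq p q) (x ⊗ y) = x ⊗ (y * q) ⊗ p - x ⊗ q ⊗ (p * y).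
Proof.
have hb := assoc3_bilin x.
rewrite /dright tlift_tensor; last by apply: dright_bilin; exact: pEq_linear.
by rewrite pEqE tliftD // tliftN // !tlift_tensor.
Qed.

Lemma sn_bracket_pEq p q r s a :
  sn_bracket (pEq p q) (pEq r s) a = anchor (free_br_val (q * p) r s) a.
Proof.
have l1 := pEq_linear p q; have l2 := pEq_linear r s.
have t1 := trilin23 A; have t2 := trilin12 A.
have t3 := trilin_cl A; have t4 := trilin_cr A.
rewrite /free_br_val !(anchorD, anchorN) !anchorE !pEqE.
rewrite /sn_bracket /sn_l /sn_r !pEqE !(dleftB, drightB) //.
rewrite !(dleft_pEq, dright_pEq) /perm23 /perm12.
rewrite !(tlift3D t1, tlift3N t1, tlift3D t2, tlift3N t2).
rewrite !(tlift3E _ _ _ t1, tlift3E _ _ _ t2).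
rewrite !(tlift3D t3, tlift3N t3, tlift3D t4, tlift3N t4).
rewrite !(tlift3E _ _ _ t3, tlift3E _ _ _ t4).
rewrite !opprD !opprK !mulrA !addrA.
rewrite [LHS](ACl (1*3*5*4*9*16*10*12*(7*2)*(6*13)*(15*8)*(14*11))).
by rewrite /= !subrr !addr0.
Qed.

Lemma foldlD s t :
  tlift3 (fun x y b : A => (x * b) ⊗ y) (perm23 (s + t)) =
  tlift3 (fun x y b => (x * b) ⊗ y) (perm23 s) +
  tlift3 (fun x y b => (x * b) ⊗ y) (perm23 t).
Proof. by rewrite /perm23 (tlift3D (trilin23 A)) (tlift3D (trilin_cl A)). Qed.

Lemma foldrD s t :
  tlift3 (fun b x y : A => x ⊗ (b * y)) (perm12 (s + t)) =
  tlift3 (fun b x y => x ⊗ (b * y)) (perm12 s) +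
  tlift3 (fun b x y => x ⊗ (b * y)) (perm12 t).
Proof. by rewrite /perm12 (tlift3D (trilin12 A)) (tlift3D (trilin_cr A)). Qed.

Lemma sn_bracketDl (d d' D : A -> AA) a : linear d -> linear d' -> linear D ->
  sn_bracket (fun x => d x + d' x) D a = sn_bracket d D a + sn_bracket d' D a.
Proof.
move=> hd hd' hD.
have eL t : dleft (fun x => d x + d' x) t = dleft d t + dleft d' t.
  rewrite -[in RHS](scale1r (dleft d t)); apply: tlift_linearf => u v.
  by rewrite tensorDl scale1r.
have eR t : dright (fun x => d x + d' x) t = dright d t + dright d' t.
  rewrite -[in RHS](scale1r (dright d t)); apply: tlift_linearf => u v.
  by rewrite scale1r tliftD //; exact: assoc3_bilin.
have mL t u : dleft D (t + u) = dleft D t + dleft D u by rewrite /dleft tmapD.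
have mR t u : dright D (t + u) = dright D t + dright D u.
  by rewrite /dright tliftD //; exact: dright_bilin.
rewrite /sn_bracket /sn_l /sn_r eL eR mL mR !opprD.
rewrite [X in perm23 X]addrACA [X in perm12 X]addrACA.
by rewrite [in LHS]foldlD [in LHS]foldrD addrACA.
Qed.

Lemma sn_bracketDr (d D D' : A -> AA) a : linear d -> linear D -> linear D' ->
  sn_bracket d (fun x => D x + D' x) a = sn_bracket d D a + sn_bracket d D' a.
Proof.
move=> hd hD hD'.
have eL t : dleft (fun x => D x + D' x) t = dleft D t + dleft D' t.
  rewrite -[in RHS](scale1r (dleft D t)); apply: tlift_linearf => u v.
  by rewrite tensorDl scale1r.
have eR t : dright (fun x => D x + D' x) t = dright D t + dright D' t.
  rewrite -[in RHS](scale1r (dright D t)); apply: tlift_linearf => u v.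
  by rewrite scale1r tliftD //; exact: assoc3_bilin.
have mL t u : dleft d (t + u) = dleft d t + dleft d u by rewrite /dleft tmapD.
have mR t u : dright d (t + u) = dright d t + dright d u.
  by rewrite /dright tliftD //; exact: dright_bilin.
rewrite /sn_bracket /sn_l /sn_r eL eR mL mR !opprD.
rewrite [X in perm23 X]addrACA [X in perm12 X]addrACA.
by rewrite [in LHS]foldlD [in LHS]foldrD addrACA.
Qed.

Lemma sn_bracket0l (D : A -> AA) a : linear D -> sn_bracket (fun=> 0) D a = 0.
Proof.
move=> hD; have hz : linear (fun _ : A => 0 : AA) by move=> c x y; rewrite scaler0 addr0.
have := sn_bracketDl a hz hz hD.
rewrite (_ : (fun _ : A => 0 + 0) = (fun=> 0 : AA)); last by apply/funext => x; rewrite addr0.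
by move=> h; apply: (addrI (sn_bracket (fun=> 0) D a)); rewrite -h addr0.
Qed.

Lemma sn_bracket0r (d : A -> AA) a : linear d -> sn_bracket d (fun=> 0) a = 0.
Proof.
move=> hD; have hz : linear (fun _ : A => 0 : AA) by move=> c x y; rewrite scaler0 addr0.
have := sn_bracketDr a hD hz hz.
rewrite (_ : (fun _ : A => 0 + 0) = (fun=> 0 : AA)); last by apply/funext => x; rewrite addr0.
by move=> h; apply: (addrI (sn_bracket d (fun=> 0) a)); rewrite -h addr0.
Qed.

Lemma free_bracketDl P P' Q :
  free_bracket (P + P') Q = free_bracket P Q + free_bracket P' Q.
Proof. by rewrite /free_bracket tliftD //; exact: free_bracket_bilin. Qed.

Lemma free_bracketDr P Q Q' :
  free_bracket P (Q + Q') = free_bracket P Q + free_bracket P Q'.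
Proof.
rewrite -[in RHS](scale1r (free_bracket P Q)); apply: tlift_linearf => p q.
by rewrite scale1r !free_br_fun tliftD //; exact: free_br_val_bilin.
Qed.

Lemma anchor_add P Q : anchor (P + Q) = (fun a => anchor P a + anchor Q a).
Proof. by apply/funext => a; exact: anchorD. Qed.

Lemma anchor_zero : anchor 0 = (fun=> 0).
Proof. by apply/funext => a; exact: anchor0. Qed.

Lemma sn_bracket_anchor P Q :
  sn_bracket (anchor P) (anchor Q) = anchor (free_bracket P Q).
Proof.
apply/funext => a; elim/tens_ind: P => [|x y hx hy|p q].
- rewrite anchor_zero sn_bracket0l; last exact: anchor_linear.
  by rewrite /free_bracket tlift0 ?anchor0 //; exact: free_bracket_bilin.
- by rewrite anchor_add sn_bracketDl ?hx ?hy ?free_bracketDl ?anchorD //;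
     exact: anchor_linear.
elim/tens_ind: Q => [|x y hx hy|r s].
- rewrite anchor_zero sn_bracket0r; last exact: anchor_linear.
  rewrite (_ : free_bracket (p ⊗ q) 0 = 0) ?anchor0 //.
  by apply: (addrI (free_bracket (p ⊗ q) 0)); rewrite -free_bracketDr !addr0.
- by rewrite anchor_add sn_bracketDr ?hx ?hy ?free_bracketDr ?anchorD //;
     exact: anchor_linear.
by rewrite !anchorE sn_bracket_pEq free_bracketE.
Qed.

Lemma anchor_gauge P : anchor P \in gauge_pred.
Proof.
apply/asboolP; exists (repr P); apply/funext => a.
by rewrite /anchor /tlift /tsum.
Qed.

Lemma pEq_sum_anchor s : pEq_sum s = anchor (\sum_(pq <- s) pq.1 ⊗ pq.2).
Proof.
apply/funext => a; rewrite /pEq_sum.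
rewrite (big_morph (anchor^~ a) (fun P Q => anchorD P Q a) (anchor0 a)).
by apply: eq_bigr => pq _; rewrite anchorE.
Qed.

Lemma sn_bracket_gauge (T T' : gauge) : sn_bracket T T' \in gauge_pred.
Proof.
have [s ->] := gauge_presented T; have [t ->] := gauge_presented T'.
by rewrite !pEq_sum_anchor sn_bracket_anchor anchor_gauge.
Qed.

End Gauge.

(* The K-algebra freely generated by A and G modulo the linear structures of   *)
(* A and G, the product and the unit of A, and the commutation relations       *)
(* g1 g2 - g2 g1 = g3 for br g1 g2 g3, and g a - a g = act g a.                *)

Inductive sd_term (K A G : Type) : Type :=
| TA of A
| TG of G
| TZero
| TOne
| TAdd of sd_term K A G & sd_term K A G
| TMul of sd_term K A G & sd_term K A G
| TScale of K & sd_term K A G.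

Arguments TA {K A G}. Arguments TG {K A G}.
Arguments TZero {K A G}. Arguments TOne {K A G}.
Arguments TAdd {K A G}. Arguments TMul {K A G}. Arguments TScale {K A G}.

Section Semidirect.
Variables (K : fieldType) (A : algType K) (G : lmodType K).
Variables (act : G -> A -> A) (br : G -> G -> G -> Prop).
Local Notation term := (sd_term K A G).
Local Notation "s - t" := (TAdd s (TScale (-1) t)) : sd_scope.
Local Notation "s * t" := (TMul s t) : sd_scope.
Local Notation "s + t" := (TAdd s t) : sd_scope.
Delimit Scope sd_scope with sd.

Inductive sd_eq : term -> term -> Prop :=
| sd_refl x : sd_eq x x
| sd_sym x y : sd_eq x y -> sd_eq y x
| sd_trans x y z : sd_eq x y -> sd_eq y z -> sd_eq x z
| sd_congD x x' y y' : sd_eq x x' -> sd_eq y y' -> sd_eq (x + y)%sd (x' + y')%sd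
| sd_congM x x' y y' : sd_eq x x' -> sd_eq y y' -> sd_eq (x * y)%sd (x' * y')%sd
| sd_congZ c x x' : sd_eq x x' -> sd_eq (TScale c x) (TScale c x')
| sd_addA x y z : sd_eq (x + (y + z))%sd ((x + y) + z)%sd
| sd_addC x y : sd_eq (x + y)%sd (y + x)%sd
| sd_add0 x : sd_eq (TZero + x)%sd x
| sd_addN x : sd_eq (TScale (-1) x + x)%sd TZero
| sd_mulA x y z : sd_eq (x * (y * z))%sd ((x * y) * z)%sd
| sd_mul1 x : sd_eq (TOne * x)%sd x
| sd_1mul x : sd_eq (x * TOne)%sd x
| sd_mulDl x y z : sd_eq ((x + y) * z)%sd (x * z + y * z)%sd
| sd_mulDr x y z : sd_eq (x * (y + z))%sd (x * y + x * z)%sd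
| sd_scaleA c d x : sd_eq (TScale c (TScale d x)) (TScale (c * d) x)
| sd_scale1 x : sd_eq (TScale 1 x) x
| sd_scaleDr c x y : sd_eq (TScale c (x + y)%sd) (TScale c x + TScale c y)%sd
| sd_scaleDl c d x : sd_eq (TScale (c + d) x) (TScale c x + TScale d x)%sd
| sd_scaleAl c x y : sd_eq (TScale c (x * y)%sd) (TScale c x * y)%sd
| sd_scaleAr c x y : sd_eq (TScale c (x * y)%sd) (x * TScale c y)%sd
| sd_linA c a b : sd_eq (TA (c *: a + b)) (TScale c (TA a) + TA b)%sd
| sd_linG c g h : sd_eq (TG (c *: g + h)) (TScale c (TG g) + TG h)%sd
| sd_unitA : sd_eq (TA 1) TOne
| sd_brG g1 g2 g3 : br g1 g2 g3 ->
    sd_eq (TG g1 * TG g2 - TG g2 * TG g1)%sd (TG g3)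
| sd_mulAA a b : sd_eq (TA a * TA b)%sd (TA (a * b))
| sd_actGA g a : sd_eq (TG g * TA a - TA a * TG g)%sd (TA (act g a)).

HB.instance Definition _ := gen_eqMixin term.
HB.instance Definition _ := gen_choiceMixin term.

Definition sd_rel (x y : term) : bool := `[< sd_eq x y >].

Lemma sd_rel_equiv : equiv_class_of sd_rel.
Proof.
split=> [x|x y|y x z]; first exact/asboolP/sd_refl.
- by apply/asboolP/asboolP => /sd_sym.
- by move=> /asboolP h1 /asboolP h2; apply/asboolP/(sd_trans h1 h2).
Qed.

Canonical sd_equiv := EquivRelPack sd_rel_equiv.

Definition semidirect := {eq_quot sd_rel}.
HB.instance Definition _ := Choice.on semidirect.
HB.instance Definition _ := EqQuotient.on semidirect.

Definition sd_pi (x : term) : semidirect := \pi_semidirect x.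

Lemma sd_piP x y : sd_eq x y <-> sd_pi x = sd_pi y.
Proof.
split=> [h|h]; first by apply/eqquotP/asboolP.
by have /eqquotP/asboolP := h.
Qed.

Lemma sd_reprP x : sd_eq (repr (sd_pi x)) x.
Proof. by apply/sd_piP; exact: reprK. Qed.

Lemma sd_ind (P : semidirect -> Prop) : (forall x, P (sd_pi x)) -> forall x, P x.
Proof. by move=> h x; rewrite -[x]reprK; exact: h. Qed.

Definition sd_add (x y : semidirect) := sd_pi (repr x + repr y)%sd.
Definition sd_mul (x y : semidirect) := sd_pi (repr x * repr y)%sd.
Definition sd_scale (c : K) (x : semidirect) := sd_pi (TScale c (repr x)).
Definition sd_opp (x : semidirect) := sd_scale (-1) x.

Lemma sd_addE x y : sd_add (sd_pi x) (sd_pi y) = sd_pi (x + y)%sd.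
Proof. by apply/sd_piP/sd_congD; exact: sd_reprP. Qed.
Lemma sd_mulE x y : sd_mul (sd_pi x) (sd_pi y) = sd_pi (x * y)%sd.
Proof. by apply/sd_piP/sd_congM; exact: sd_reprP. Qed.
Lemma sd_scaleE c x : sd_scale c (sd_pi x) = sd_pi (TScale c x).
Proof. by apply/sd_piP/sd_congZ; exact: sd_reprP. Qed.

Let sdE := (sd_addE, sd_mulE, sd_scaleE).

Lemma sdr_addA : associative sd_add.
Proof.
by elim/sd_ind=> x; elim/sd_ind=> y; elim/sd_ind=> z; rewrite !sdE;
   apply/sd_piP/sd_addA.
Qed.
Lemma sdr_addC : commutative sd_add.
Proof. by elim/sd_ind=> x; elim/sd_ind=> y; rewrite !sdE; apply/sd_piP/sd_addC. Qed.
Lemma sdr_add0 : left_id (sd_pi TZero) sd_add.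
Proof. by elim/sd_ind=> x; rewrite !sdE; apply/sd_piP/sd_add0. Qed.
Lemma sdr_addN : left_inverse (sd_pi TZero) sd_opp sd_add.
Proof. by elim/sd_ind=> x; rewrite /sd_opp !sdE; apply/sd_piP/sd_addN. Qed.
HB.instance Definition _ :=
  GRing.isZmodule.Build semidirect sdr_addA sdr_addC sdr_add0 sdr_addN.

Lemma sdr_mulA : associative sd_mul.
Proof.
by elim/sd_ind=> x; elim/sd_ind=> y; elim/sd_ind=> z; rewrite !sdE;
   apply/sd_piP/sd_mulA.
Qed.
Lemma sdr_mul1 : left_id (sd_pi TOne) sd_mul.
Proof. by elim/sd_ind=> x; rewrite !sdE; apply/sd_piP/sd_mul1. Qed.
Lemma sdr_1mul : right_id (sd_pi TOne) sd_mul.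
Proof. by elim/sd_ind=> x; rewrite !sdE; apply/sd_piP/sd_1mul. Qed.
Lemma sdr_mulDl : left_distributive sd_mul +%R.
Proof.
by elim/sd_ind=> x; elim/sd_ind=> y; elim/sd_ind=> z;
   rewrite /GRing.add /= !sdE; apply/sd_piP/sd_mulDl.
Qed.
Lemma sdr_mulDr : right_distributive sd_mul +%R.
Proof.
by elim/sd_ind=> x; elim/sd_ind=> y; elim/sd_ind=> z;
   rewrite /GRing.add /= !sdE; apply/sd_piP/sd_mulDr.
Qed.
HB.instance Definition _ := GRing.Zmodule_isPzRing.Build semidirect
  sdr_mulA sdr_mul1 sdr_1mul sdr_mulDl sdr_mulDr.

Lemma sdr_scaleA c d x : sd_scale c (sd_scale d x) = sd_scale (c * d) x.
Proof. by elim/sd_ind: x => x; rewrite !sdE; apply/sd_piP/sd_scaleA. Qed.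
Lemma sdr_scale1 : left_id 1 sd_scale.
Proof. by elim/sd_ind=> x; rewrite !sdE; apply/sd_piP/sd_scale1. Qed.
Lemma sdr_scaleDr : right_distributive sd_scale +%R.
Proof.
by move=> c; elim/sd_ind=> x; elim/sd_ind=> y;
   rewrite /GRing.add /= !sdE; apply/sd_piP/sd_scaleDr.
Qed.
Lemma sdr_scaleDl x : {morph sd_scale^~ x : c d / c + d}.
Proof.
by move=> c d; elim/sd_ind: x => x;
   rewrite [in RHS]/GRing.add /= !sdE; apply/sd_piP/sd_scaleDl.
Qed.
HB.instance Definition _ := GRing.Zmodule_isLmodule.Build K semidirect
  sdr_scaleA sdr_scale1 sdr_scaleDr sdr_scaleDl.

Lemma semidirect_scalerAl c (x y : semidirect) : c *: (x * y) = (c *: x) * y.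
Proof.
elim/sd_ind: x => x; elim/sd_ind: y => y.
by rewrite /GRing.scale /GRing.mul /= !sdE; apply/sd_piP/sd_scaleAl.
Qed.
Lemma semidirect_scalerAr c (x y : semidirect) : c *: (x * y) = x * (c *: y).
Proof.
elim/sd_ind: x => x; elim/sd_ind: y => y.
by rewrite /GRing.scale /GRing.mul /= !sdE; apply/sd_piP/sd_scaleAr.
Qed.

Definition sdA (a : A) : semidirect := sd_pi (TA a).
Definition sdG (g : G) : semidirect := sd_pi (TG g).

End Semidirect.

(* Varieties in the classical sense: a point set T with a set of K-valued      *)
(* coordinate functions.                                                       *)

Section Variety.
Variables (K : fieldType) (T : Type) (coords : set (T -> K)).

Inductive polyfun : (T -> K) -> Prop :=
| poly_cst c : polyfun (fun=> c)
| poly_coord f of coords f : polyfun f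
| poly_add f g of polyfun f & polyfun g : polyfun (fun x => f x + g x)
| poly_mul f g of polyfun f & polyfun g : polyfun (fun x => f x * g x).

Definition zariski_open (U : set T) := forall x, U x ->
  exists f, [/\ polyfun f, f x != 0 & forall y, f y != 0 -> U y].

Record zopen := ZOpen { zset :> set T; zopenP : zariski_open zset }.

Definition regular (U : set T) : {pred set_type U -> K} := fun f =>
  `[< forall x : set_type U, exists p q,
      [/\ polyfun p, polyfun q, q (val x) != 0 &
        forall y : set_type U, q (val y) != 0 ->
          f y = p (val y) / q (val y)] >].

Lemma regular_subring U : subring_closed (@regular U).
Proof.
have op f g (F : K -> K -> K) (P : (T -> K) -> (T -> K) -> (T -> K) -> (T -> K) -> T -> K) :
  (forall p q p' q', polyfun p -> polyfun q -> polyfun p' -> polyfun q' ->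
     polyfun (P p q p' q')) ->
  (forall p q p' q' x, q x != 0 -> q' x != 0 ->
     F (p x / q x) (p' x / q' x) = P p q p' q' x / (q x * q' x)) ->
  f \in @regular U -> g \in @regular U ->
  (fun x => F (f x) (g x)) \in @regular U.
  move=> hP hF /asboolP hf /asboolP hg; apply/asboolP => x.
  have [p [q [pp pq qx fE]]] := hf x; have [p' [q' [pp' pq' qx' gE]]] := hg x.
  exists (P p q p' q'), (fun y => q y * q' y); split.
  - exact: hP.
  - exact: poly_mul.
  - by rewrite mulf_neq0.
  - by move=> y; rewrite mulf_eq0 negb_or => /andP[h h']; rewrite fE // gE // hF.
split.
- apply/asboolP => x; exists (fun=> 1), (fun=> 1).
  by split; [exact: poly_cst|exact: poly_cst|exact: oner_neq0|rewrite divr1].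
- move=> f g hf hg.
  apply: (op f g (fun a b => a - b)
            (fun p q p' q' x => p x * q' x + -1 * (p' x * q x))) => //.
    move=> p q p' q' ? ? ? ?; apply: poly_add; first exact: poly_mul.
    by apply: poly_mul; [exact: poly_cst|exact: poly_mul].
  by move=> p q p' q' x h h'; rewrite mulN1r -mulNr addf_div // mulNr.
- move=> f g hf hg.
  apply: (op f g (fun a b => a * b) (fun p q p' q' x => p x * p' x)) => //.
    by move=> p q p' q' ? ? ? ?; exact: poly_mul.
  by move=> p q p' q' x h h'; rewrite mulf_div.
Qed.

HB.instance Definition _ U :=
  GRing.isSubringClosed.Build (set_type U -> K) (@regular U) (regular_subring U).

Record structure_sheaf (U : set T) :=
  RegularFun { reg_val : set_type U -> K; _ : reg_val \in @regular U }.

HB.instance Definition _ U := [isSub for @reg_val U].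
HB.instance Definition _ U := [Choice of structure_sheaf U by <:].
HB.instance Definition _ U := GRing.SubChoice_isSubComPzRing.Build _ _
  (structure_sheaf U) (subringClosedP (@regular U)).

(* Extension by zero outside U. *)
Definition ext U (h : structure_sheaf U) (x : T) : K :=
  if pselect (U x) is left Ux then reg_val h (SigSub (mem_set Ux)) else 0.

(* The restriction to U of a function which is regular there, and 0 otherwise. *)
Definition to_reg U (h : T -> K) : structure_sheaf U :=
  insubd 0 (fun x : set_type U => h (val x)).

End Variety.

Section RepresentationSpace.
Variables (K : fieldType) (A : algType K) (N : nat).

Definition rep : Type := {lrmorphism A -> 'M[K]_N}.

Definition GL : Type := {g : 'M[K]_N | g \in unitmx}.
Definition gl_one : GL := exist _ 1%:M (unitmx1 K N).
(* Total: gl_one on the singular matrices. *)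
Definition to_GL (m : 'M[K]_N) : GL := insubd gl_one m.
Definition gl_mul (g h : GL) : GL := to_GL (val g *m val h).
Definition gl_inv (g : GL) : GL := to_GL (invmx (val g)).

Definition conj_rep (g : GL) (r : rep) (a : A) : 'M[K]_N :=
  val g *m r a *m invmx (val g).

Lemma conj_rep_linear g r : linear (conj_rep g r).
Proof.
by move=> c a b; rewrite /conj_rep linearP mulmxDr mulmxDl -scalemxAr -scalemxAl.
Qed.
Lemma conj_rep_mul g r : monoid_morphism (conj_rep g r).
Proof.
split=> [|a b]; rewrite /conj_rep.
  by rewrite rmorph1 mulmx1 mulmxV // (valP g).
rewrite rmorphM -[RHS]mulmxA (mulmxA (invmx _)) (mulmxA (invmx _)).
by rewrite mulVmx ?(valP g) // mul1mx !mulmxA.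
Qed.

HB.instance Definition _ g r :=
  GRing.isLinear.Build K A 'M[K]_N *:%R (conj_rep g r) (conj_rep_linear g r).
HB.instance Definition _ g r :=
  GRing.isMonoidMorphism.Build A 'M[K]_N (conj_rep g r) (conj_rep_mul g r).

Definition rep_act (g : GL) (r : rep) : rep := conj_rep g r.

End RepresentationSpace.

Section RepresentationVariety.
Variables (K : fieldType) (A : algType K) (N : nat).
Local Notation X := (rep A N).
Local Notation G := (GL K N).

Definition rep_coords : set (X -> K) :=
  [set f | exists a p q, f = fun r : X => r a p q].

(* coordinates of GL_N x Rep: the entries of g, det(g)^-1 and the a_(p,q) *)
Definition gl_rep_coords : set (G * X -> K) :=
  [set f | [\/ exists p q, f = fun z : G * X => val z.1 p q,
               f = fun z : G * X => (\det (val z.1))^-1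
             | exists a p q, f = fun z : G * X => z.2 a p q]].

Local Notation openX := (zopen rep_coords).
Local Notation O := (structure_sheaf rep_coords).
Implicit Types U V W : openX.

Definition coord (U : openX) (a : A) (p q : 'I_N) : O U :=
  to_reg rep_coords U (fun r : X => r a p q).

Record O_module := OModule {
  sec :> forall U : openX, lmodType (O U);
  restr : forall U V : openX, V `<=` U -> sec U -> sec V;
  restrD : forall U V (h : V `<=` U) x y,
    restr h (x + y) = restr h x + restr h y;
  restrZ : forall U V (h : V `<=` U) a x,
    restr h (a *: x) = to_reg rep_coords V (ext a) *: restr h x;
  restr_id : forall U (h : U `<=` U) x, restr h x = x;
  restr_comp : forall U V W (hVU : V `<=` U) (hWV : W `<=` V) (hWU : W `<=` U) x,
    restr hWV (restr hVU x) = restr hWU x;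
  sec_separated : forall U (I : Type) (V : I -> openX) (hV : forall i, V i `<=` U),
    U `<=` \bigcup_i V i ->
    forall x y, (forall i, restr (hV i) x = restr (hV i) y) -> x = y;
  sec_glue : forall U (I : Type) (V : I -> openX) (hV : forall i, V i `<=` U),
    U `<=` \bigcup_i V i ->
    forall s : (forall i, sec (V i)),
    (forall i j (W : openX) (hi : W `<=` V i) (hj : W `<=` V j),
       restr hi (s i) = restr hj (s j)) ->
    exists x, forall i, restr (hV i) x = s i
}.

(* V is contained in g U. *)
Definition sub_translate (g : G) (U V : openX) :=
  forall r, zset V r -> zset U (rep_act (gl_inv g) r).

(* [transl g] sends a section f over U to the section g.f over an open V inside *)
(* g U.  In [local_expansion], g.f is near the point considered the section     *)
(* sum_i c_i(g, -) f_i, with c_i regular on an open of GL_N x Rep: an           *)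
(* isomorphism act^*F = pr^*F sends act^*f to sum_i c_i (x) f_i, and both sides *)
(* are determined by their restrictions to the slices {g} x Rep.                *)
Section Expansion.
Variables (F : O_module)
  (transl : forall g (U V : openX), sub_translate g U V -> F U -> F V).

Definition local_expansion (U : openX) (f : F U)
    (D : zopen gl_rep_coords) (V : openX)
    (s : seq (structure_sheaf gl_rep_coords D * F V)) :=
  (forall g r, zset D (g, r) -> zset V r /\ zset U (rep_act (gl_inv g) r)) /\
  forall g (W : openX) (hU : sub_translate g U W) (hV : W `<=` V),
    (forall r, zset W r -> zset D (g, r)) ->
    transl hU f =
      \sum_(cm <- s) to_reg rep_coords W (fun r => ext cm.1 (g, r)) *: restr hV cm.2.

End Expansion.

Record equivariant_O_module := EquivariantOModule {
  eq_sheaf :> O_module;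
  transl : forall g (U V : openX), sub_translate g U V -> eq_sheaf U -> eq_sheaf V;
  translD : forall g U V (h : sub_translate g U V) x y,
    transl h (x + y) = transl h x + transl h y;
  translZ : forall g U V (h : sub_translate g U V) a x,
    transl h (a *: x) =
      to_reg rep_coords V (fun r => ext a (rep_act (gl_inv g) r)) *: transl h x;
  transl1 : forall U V (h : sub_translate (gl_one K N) U V) (h' : V `<=` U) x,
    transl h x = restr h' x;
  translM : forall g h U V W (hUV : sub_translate h U V) (hVW : sub_translate g V W)
    (hUW : sub_translate (gl_mul g h) U W) x,
    transl hVW (transl hUV x) = transl hUW x;
  transl_algebraic : forall (U : openX) (f : eq_sheaf U) r, zset U r ->
    exists (D : zopen gl_rep_coords) (V : openX) s,
      local_expansion transl f (D := D) (V := V) s /\ zset D (gl_one K N, r)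
}.

(* phi is near 0 the rational function P / Q, and d is its derivative at 0. *)
Definition has_deriv0 (phi : K -> K) (d : K) := exists P Q : {poly K},
  [/\ Q.[0] != 0, (forall t, Q.[t] != 0 -> phi t = P.[t] / Q.[t])
    & d = (P^`().[0] * Q.[0] - P.[0] * Q^`().[0]) / Q.[0] ^+ 2].

Definition deriv0 (phi : K -> K) : K := xget 0 [set d | has_deriv0 phi d].

Definition gl_curve (c : 'M[K]_N) (t : K) : G := to_GL (1%:M + t *: c).

(* The action of c in gl_N on functions: d/dt at 0 of h(exp(-tc).r). *)
Definition lie_fun (c : 'M[K]_N) (U : openX) (h : O U) : O U :=
  to_reg rep_coords U
    (fun r => deriv0 (fun t => ext h (rep_act (gl_inv (gl_curve c t)) r))).

Definition lie_bracket (c d : 'M[K]_N) := c *m d - d *m c.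

(* The differential of the action of GL_N on F. *)
Record infinitesimal_action (F : equivariant_O_module)
    (kappa : 'M[K]_N -> forall U : openX, F U -> F U) : Prop := InfinitesimalAction {
  kappa_restr : forall c (U V : openX) (h : V `<=` U) x,
    restr h (kappa c U x) = kappa c V (restr h x);
  kappaD : forall c U x y, kappa c U (x + y) = kappa c U x + kappa c U y;
  kappa_linear : forall (l : K) c d U x,
    kappa (l *: c + d) U x =
      to_reg rep_coords U (fun=> l) *: kappa c U x + kappa d U x;
  kappa_lie : forall c d U x,
    kappa (lie_bracket c d) U x =
      kappa c U (kappa d U x) - kappa d U (kappa c U x);
  kappa_leibniz : forall c U (h : O U) x,
    kappa c U (h *: x) = lie_fun c h *: x + h *: kappa c U x;
  kappa_differential : forall c (U : openX) (f : F U)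
      (D : zopen gl_rep_coords) (V : openX) s,
    local_expansion (@transl F) f (D := D) (V := V) s ->
    forall (W : openX) (hU : W `<=` U) (hV : W `<=` V),
      (forall r, zset W r -> zset D (gl_one K N, r)) ->
      restr hU (kappa c U f) =
        \sum_(cm <- s) to_reg rep_coords W
          (fun r => deriv0 (fun t => ext cm.1 (gl_curve c t, r))) *: restr hV cm.2
}.

Section Action.
Variables (F : equivariant_O_module)
  (kappa : 'M[K]_N -> forall U : openX, F U -> F U).


(* The sections of E_N (x) F over U are the matrices 'M[F U]_N. *)
Definition act_fun (U : openX) (a : A) (f : 'M[F U]_N) : 'M[F U]_N :=
  \matrix_(u, v) \sum_w coord U a u w *: f w v.

(* T_(i,i) for T = sum_(p, q in s) pEq *)
Definition theta_ii (s : seq (A * A)) (i : 'I_N) (U : openX) (f : F U) : F U :=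
  \sum_(pq <- s) \sum_k \sum_l
    (coord U pq.1 i l * coord U pq.2 k i) *: kappa (delta_mx k l) f.

Definition act_theta (s : seq (A * A)) (U : openX) (f : 'M[F U]_N) : 'M[F U]_N :=
  \matrix_(u, v) \sum_i theta_ii s i (f u v).

Section ModuleStructure.
Variables (Gg : lmodType K) (act : Gg -> A -> A) (br : Gg -> Gg -> Gg -> Prop).
Local Notation S := (semidirect act br).

Record sheaf_left_module (m : forall U : openX, S -> 'M[F U]_N -> 'M[F U]_N)
  : Prop := SheafLeftModule {
  slm_one : forall U f, m U 1 f = f;
  slm_mul : forall U x y f, m U (x * y) f = m U x (m U y f);
  slm_addl : forall U x y f, m U (x + y) f = m U x f + m U y f;
  slm_addr : forall U x f g, m U x (f + g) = m U x f + m U x g;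
  slm_scalel : forall U (c : K) x f, m U (c *: x) f =
    map_mx (fun y => to_reg rep_coords U (fun=> c) *: y) (m U x f);
  slm_scaler : forall U (c : K) x f,
    m U x (map_mx (fun y => to_reg rep_coords U (fun=> c) *: y) f) =
    map_mx (fun y => to_reg rep_coords U (fun=> c) *: y) (m U x f);
  slm_restr : forall (U V : openX) (h : V `<=` U) x f,
    map_mx (restr h) (m U x f) = m V x (map_mx (restr h) f)
}.

(* [presents g s]: g is the sum of the pEq, for (p, q) in s. *)
Definition gauge_action_is_module (presents : Gg -> seq (A * A) -> Prop) :=
  exists m : forall U : openX, S -> 'M[F U]_N -> 'M[F U]_N,
    [/\ sheaf_left_module m,
        forall U a f, m U (sdA act br a) f = act_fun a f
      & forall U g s f, presents g s -> m U (sdG act br g) f = act_theta s f].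

End ModuleStructure.

End Action.

End RepresentationVariety.

Section Conclusion.
Variables (K : fieldType) (A : algType K) (H : hamiltonian_space A) (N : nat).
Variables (F : equivariant_O_module A N)
  (kappa : 'M[K]_N -> forall U : zopen (@rep_coords K A N), F U -> F U).

(* A x| G^A for the sub-bimodule G^A of the double derivations *)
Definition gauge_module : Prop :=
  gauge_action_is_module kappa
    (fun (T : gauge H) a => sn_act T a)
    (fun T1 T2 T3 : gauge H => gauge_val T3 = sn_bracket T1 T2)
    (fun T s => gauge_val T = pEq_sum H s).

(* A x| G^A for the free bimodule G^A = A (x) A on the generator E *)
Definition free_gauge_module : Prop :=
  gauge_action_is_module kappa
    (fun (P : tens A A) a => sn_act (anchor H P) a)
    (fun P1 P2 P3 : tens A A => P3 = free_bracket P1 P2)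
    (fun P s => P = \sum_(pq <- s) pq.1 ⊗ pq.2).

(* The formula for the sum of the T_(i,i) depends only on the double derivation *)
(* T, and not on its expression as a sum of terms pEq. *)
Definition action_well_defined : Prop :=
  forall s t : seq (A * A), pEq_sum H s = pEq_sum H t ->
  forall U (f : 'M[F U]_N), act_theta kappa s f = act_theta kappa t f.

End Conclusion.

(* Main.v *)
From HB Require Import structures.
From Pilot Require Import Defs.
From mathcomp Require Import all_boot all_algebra all_classical ring.

(** Write m = qp for a generator pEq of the gauge bimodule. Since a |-> (a) is
    multiplicative, the sum over i of the operators (pEq)_(i,i) on sections is
      L(m) = sum over k, l of (m)_(k,l) kappa(e_(k,l)),
    so everything is controlled by the element m of A ([gauge_op], [act_thetaE]).

    The algebra A acts by matrix multiplication. Two relations involve L.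
    - The elementary matrix e_(k,l) acts on the coordinate functions by the commutator
      of (a) with e_(k,l), as one sees by differentiating (1 + tc)^-1 (a) (1 + tc) at
      t = 0 ([lie_fun_coord]). By O-linearity L(m) acts on them by the commutator
      (am - ma), which is therefore the commutator of L(m) with multiplication by (a)
      ([gauge_op_coord]). The action of pEq on a is the same element of A, for the
      product of the factors of pEq(a) = aq (x) p - q (x) pa is am - ma
      ([sn_act_anchor]).
    - The coefficients of L(m') are differentiated by L(m), and kappa is a Lie map; the
      two effects add up to L(m)L(m') - L(m')L(m) = L(m'm - mm') ([gauge_op_bracket]). The
      Schouten bracket of pEq and p'Eq' is also sent to m'm - mm'
      ([opmul_free_bracket]).

    The relations hold already for formal sums of terms pEq, that is, for the free
    bimodule on E. For a quotient of the free bimodule they persist as soon as L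
    factors through the quotient ([gauge_quotient_module]), and the semidirect product,
    being given by generators and relations, then acts ([sd_eval_eq]). Conversely,
    an action of the semidirect product with the bimodule of double derivations gives
    one operator for each double derivation, so L factors. *)

Set Implicit Arguments.
Unset Strict Implicit.
Unset Printing Implicit Defensive.

Import GRing.Theory Pilot.Defs.
Local Open Scope classical_set_scope.
Local Open Scope ring_scope.

(** * Derivatives at zero of rational functions of one variable *)

Section DerivativeAtZero.
Variable K : closedFieldType.
Implicit Types (p P Q R : {poly K}) (phi : K -> K).

(** If p is not zero, 'X * p + 1 is not constant, so it has a root; but p vanishes
    there, and the value is 1. *)
Lemma horner_all0 p : (forall t, p.[t] = 0) -> p = 0.
Proof.
move=> p0; apply/eqP; apply: contraT => pN0.
have /closed_rootP[x /eqP] : size (p * 'X + 1) != 1%N.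
  by rewrite -[1]/(1%:P) size_MXaddC (negPf pN0) /= eqSS size_poly_eq0.
by rewrite !hornerE p0 mul0r add0r => /eqP; rewrite oner_eq0.
Qed.

(** Two fractions which agree wherever both are defined agree as fractions,
    because K is infinite; so they have the same derivative. *)
Lemma has_deriv0_unique phi d d' : has_deriv0 phi d -> has_deriv0 phi d' -> d = d'.
Proof.
move=> [P [Q [Q0 phiE ->]]] [P' [Q' [Q'0 phiE' ->]]].
have cross : P * Q' = P' * Q.
  have QQ' : Q * Q' != 0.
    apply/eqP => /(congr1 (horner^~ 0)) /eqP.
    by rewrite hornerM horner0 mulf_eq0 (negPf Q0) (negPf Q'0).
  have : (P * Q' - P' * Q) * (Q * Q') = 0.
    apply: horner_all0 => t; rewrite !(hornerM, hornerD, hornerN).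
    have [->|Qt] := eqVneq Q.[t] 0; first by rewrite mul0r [LHS]mulr0.
    have [->|Q't] := eqVneq Q'.[t] 0; first by rewrite !mulr0.
    have := phiE _ Qt; rewrite (phiE' _ Q't) => /eqP.
    by rewrite eqr_div // => /eqP ->; rewrite subrr mul0r.
  by move/eqP; rewrite mulf_eq0 (negPf QQ') orbF subr_eq0 => /eqP.
(* The derivative at 0 of the identity P Q' = P' Q determines P'^`().[0]. *)
have := congr1 (fun p => p^`().[0]) cross; have := congr1 (horner^~ 0) cross.
rewrite !derivM !(hornerM, hornerD) => e0 e1.
have -> : P'.[0] = P.[0] * Q'.[0] / Q.[0] by rewrite e0 mulfK.
have -> : P'^`().[0] = (P^`().[0] * Q'.[0] + P.[0] * Q'^`().[0]
    - P.[0] * Q'.[0] / Q.[0] * Q^`().[0]) / Q.[0].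
  by rewrite e1 [P'.[0]](_ : _ = P.[0] * Q'.[0] / Q.[0]) ?addrK ?mulfK // e0 mulfK.
by field; rewrite Q0 Q'0.
Qed.

(** The fraction may fail to represent phi at the zeros of R as well as at those of
    Q: it suffices to multiply numerator and denominator by R. *)
Lemma deriv0E phi P Q R : Q.[0] != 0 -> R.[0] != 0 ->
  (forall t, Q.[t] != 0 -> R.[t] != 0 -> phi t = P.[t] / Q.[t]) ->
  deriv0 phi = (P^`().[0] * Q.[0] - P.[0] * Q^`().[0]) / Q.[0] ^+ 2.
Proof.
move=> Q0 R0 phiE; set d := RHS.
have hd : has_deriv0 phi d.
  exists (P * R), (Q * R); split; first by rewrite hornerE mulf_neq0.
    move=> t; rewrite !hornerE mulf_eq0 negb_or => /andP[Qt Rt].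
    by rewrite phiE // -mulf_div divff // mulr1.
  by rewrite /d !derivM !(hornerM, hornerD); field; rewrite Q0 R0.
rewrite /deriv0; case: xgetP => [e _ he|/(_ d) //].
exact: has_deriv0_unique he hd.
Qed.

End DerivativeAtZero.

(** * Regular functions given by global polynomials *)

Section RegularFunctions.
Variables (K : fieldType) (T : Type) (coords : set (T -> K)) (U : set T).
Implicit Types f g : T -> K.
Local Notation pf := (polyfun coords).
Local Notation to_reg := (to_reg coords U).

Lemma polyfun_regular f : pf f ->
  (fun x : set_type U => f (val x)) \in @regular K T coords U.
Proof.
move=> pf_f; apply/asboolP => x; exists f, (fun=> 1).
by split=> [||/=|y _]; [|exact: poly_cst|exact: oner_neq0|rewrite divr1].
Qed.

Lemma reg_val_to_reg f x : pf f -> reg_val (to_reg f) x = f (val x).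
Proof. by move=> pf_f; rewrite -[LHS]/(val _ x) insubdK //; exact: polyfun_regular. Qed.

Lemma eq_to_reg f g : (forall x, U x -> f x = g x) -> to_reg f = to_reg g.
Proof.
move=> fg; congr insubd; apply/funext => x; apply: fg.
by have := valP x; rewrite inE.
Qed.

Lemma ext_to_reg f x : pf f -> U x -> ext (to_reg f) x = f x.
Proof.
move=> pf_f Ux; rewrite /ext; case: pselect => [Ux'|/(_ Ux) //].
by rewrite reg_val_to_reg.
Qed.

Lemma to_regD f g : pf f -> pf g -> to_reg (fun x => f x + g x) = to_reg f + to_reg g.
Proof.
move=> pf_f pf_g; apply/val_inj/funext => x; rewrite raddfD /=.
rewrite -[RHS]/(reg_val _ x + reg_val _ x) !reg_val_to_reg //; exact: poly_add.
Qed.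

Lemma to_regM f g : pf f -> pf g -> to_reg (fun x => f x * g x) = to_reg f * to_reg g.
Proof.
move=> pf_f pf_g; apply/val_inj/funext => x; rewrite rmorphM /=.
by rewrite -[RHS]/(reg_val _ x * reg_val _ x) !reg_val_to_reg //; exact: poly_mul.
Qed.

Lemma to_regB f g : pf f -> pf g -> to_reg (fun x => f x - g x) = to_reg f - to_reg g.
Proof.
move=> pf_f pf_g; have pf_gN : pf (fun x => - g x).
  under eq_fun do rewrite -mulN1r; apply: poly_mul => //; exact: poly_cst.
apply: (canRL (addrK _)); rewrite -to_regD //; last exact: poly_add.
by apply: eq_to_reg => x _; rewrite subrK.
Qed.

Lemma to_reg1 : to_reg (fun=> 1) = 1.
Proof.
apply/val_inj/funext => x; rewrite rmorph1 /=.
by rewrite reg_val_to_reg //; exact: poly_cst.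
Qed.

Lemma to_reg0 : to_reg (fun=> 0) = 0.
Proof.
apply/val_inj/funext => x; rewrite raddf0 /=.
by rewrite reg_val_to_reg //; exact: poly_cst.
Qed.

Lemma poly_natb f (b : bool) : pf f -> pf (fun x => f x *+ b).
Proof. by case: b => // _; exact: (poly_cst _ 0). Qed.

Lemma to_regMb f (b : bool) : to_reg (fun x => f x *+ b) = to_reg f *+ b.
Proof. by case: b; rewrite ?mulr1n // to_reg0. Qed.

Lemma poly_sum (I : Type) (s : seq I) (F : I -> T -> K) :
  (forall i, pf (F i)) -> pf (fun x => \sum_(i <- s) F i x).
Proof.
move=> pfF; elim: s => [|i s IHs].
  by under eq_fun do rewrite big_nil; exact: poly_cst.
by under eq_fun do rewrite big_cons; exact: poly_add.
Qed.

Lemma to_reg_sum (I : Type) (s : seq I) (F : I -> T -> K) : (forall i, pf (F i)) ->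
  to_reg (fun x => \sum_(i <- s) F i x) = \sum_(i <- s) to_reg (F i).
Proof.
move=> pfF; elim: s => [|i s IHs].
  by under eq_fun do rewrite big_nil; rewrite big_nil to_reg0.
under eq_fun do rewrite big_cons; rewrite big_cons -IHs to_regD //.
exact: poly_sum.
Qed.

End RegularFunctions.

(** * Conjugation by the one-parameter curve 1 + tc *)

Section ConjugationCurve.
Variables (K : closedFieldType) (A : algType K) (N : nat).
Variables (c : 'M[K]_N) (r : rep A N).
Implicit Types (t : K) (a : A).

Definition curve_mx : 'M[{poly K}]_N := 1%:M + 'X *: map_mx polyC c.
Definition curve_det : {poly K} := \det curve_mx.
Definition curve_num a : 'M[{poly K}]_N :=
  \adj curve_mx *m map_mx polyC (r a) *m curve_mx.
(** The curve exp(-tc).r to first order, the one that differentiates functions in the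
    action of c. *)
Definition orbit_curve t : rep A N := rep_act (gl_inv (gl_curve c t)) r.

Lemma map_polyCK n (B : 'M[K]_n) t : map_mx (horner_eval t) (map_mx polyC B) = B.
Proof. by apply/matrixP => i j; rewrite !mxE horner_evalE hornerC. Qed.

Lemma eval_curve_mx t : map_mx (horner_eval t) curve_mx = 1%:M + t *: c.
Proof. by rewrite map_mxD map_mx1 map_mxZ /= /horner_eval hornerX map_polyCK. Qed.

Lemma eval_curve_det t : curve_det.[t] = \det (1%:M + t *: c).
Proof. by rewrite -eval_curve_mx det_map_mx. Qed.

Lemma eval_curve_num t a :
  map_mx (horner_eval t) (curve_num a) = \adj (1%:M + t *: c) *m r a *m (1%:M + t *: c).
Proof. by rewrite !map_mxM map_mx_adj eval_curve_mx map_polyCK. Qed.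

Lemma curve_det0 : curve_det.[0] = 1.
Proof. by rewrite eval_curve_det scale0r addr0 det1. Qed.

Lemma curve_num0 a i j : (curve_num a i j).[0] = r a i j.
Proof.
have /matrixP/(_ i j) := eval_curve_num 0 a.
by rewrite mxE horner_evalE => ->; rewrite scale0r addr0 adj1 mul1mx mulmx1.
Qed.

(** Cramer's rule for the inverse of 1 + tc. *)
Lemma orbit_curveE t a i j : curve_det.[t] != 0 ->
  orbit_curve t a i j = (curve_num a i j).[t] / curve_det.[t].
Proof.
move=> Dt; set g := 1%:M + t *: c.
have gU : g \in unitmx by rewrite unitmxE -eval_curve_det unitfE.
have valg : val (gl_curve c t) = g by rewrite val_insubd gU.
have valgV : val (gl_inv (gl_curve c t)) = invmx g.
  by rewrite val_insubd valg unitmx_inv gU.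
rewrite -[LHS]/((val (gl_inv _) *m r a *m invmx (val (gl_inv _))) i j) valgV invmxK.
have /matrixP/(_ i j) := eval_curve_num t a; rewrite mxE horner_evalE => ->.
by rewrite eval_curve_det /invmx gU -!scalemxAl mxE mulrC.
Qed.

Definition deriv0_mx n (B : 'M[{poly K}]_n) : 'M[K]_n := map_mx (fun p => p^`().[0]) B.

Lemma deriv0_mxM n (B C : 'M[{poly K}]_n) :
  deriv0_mx (B *m C) =
    deriv0_mx B *m map_mx (horner_eval 0) C + map_mx (horner_eval 0) B *m deriv0_mx C.
Proof.
apply/matrixP => i j; rewrite !mxE raddf_sum -big_split.
rewrite /= horner_sum; apply: eq_bigr => k _.
by rewrite !mxE derivM hornerD !hornerM.
Qed.

Lemma deriv0_mxC n (B : 'M[K]_n) : deriv0_mx (map_mx polyC B) = 0.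
Proof. by apply/matrixP => i j; rewrite !mxE derivC horner0. Qed.

Lemma deriv0_curve_mx : deriv0_mx curve_mx = c.
Proof.
apply/matrixP => i j; rewrite !mxE derivD derivM derivX derivC mulr0 addr0 mul1r.
by rewrite -polyC_natr derivC add0r hornerC.
Qed.

(** The derivative at 0 of the identity adj(B) B = det(B), at the point where B = 1. *)
Lemma deriv0_adj_curve : deriv0_mx (\adj curve_mx) = curve_det^`().[0]%:M - c.
Proof.
have := congr1 (@deriv0_mx N) (mul_adj_mx curve_mx).
rewrite deriv0_mxM deriv0_curve_mx map_mx_adj eval_curve_mx scale0r addr0 adj1.
rewrite mul1mx mulmx1 => /(canRL (addrK _)) ->; congr (_ - _).
by apply/matrixP => i j; rewrite !mxE derivMn hornerMn.
Qed.

(** The term in det' is the one that the quotient rule removes from the derivative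
    of curve_num a / curve_det, which leaves the commutator of (a) with c. *)
Lemma deriv0_curve_num a :
  deriv0_mx (curve_num a) = curve_det^`().[0] *: r a + (r a *m c - c *m r a).
Proof.
rewrite /curve_num !deriv0_mxM deriv0_mxC mulmx0 addr0 deriv0_adj_curve.
rewrite deriv0_curve_mx map_mxM map_mx_adj !eval_curve_mx map_polyCK.
rewrite scale0r addr0 adj1 mul1mx mulmx1 mulmxBl mul_scalar_mx.
by rewrite -addrA [_ + r a *m c]addrC.
Qed.

Lemma polyfun_orbit_curve (f : rep A N -> K) : polyfun (@rep_coords K A N) f ->
  exists (P : {poly K}) n, P.[0] = f r /\
    forall t, curve_det.[t] != 0 -> f (orbit_curve t) = P.[t] / curve_det.[t] ^+ n.
Proof.
elim=> {f} [x|f [a [i [j ->]]]|f g _ [P [n [P0 fE]]] _ [Q [m [Q0 gE]]]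
    |f g _ [P [n [P0 fE]]] _ [Q [m [Q0 gE]]]].
- by exists x%:P, 0%N; split=> [|t _]; rewrite hornerC // expr0 divr1.
- by exists (curve_num a i j), 1%N; split=> [|t Dt]; rewrite ?curve_num0 ?orbit_curveE.
- exists (P * curve_det ^+ m + Q * curve_det ^+ n), (n + m)%N; split=> [|t Dt].
    by rewrite !(hornerD, hornerM, horner_exp) P0 Q0 curve_det0 !expr1n !mulr1.
  rewrite fE // gE // !(hornerD, hornerM, horner_exp) exprD.
  by field; rewrite !expf_neq0.
- exists (P * Q), (n + m)%N; split=> [|t Dt]; first by rewrite hornerM P0 Q0.
  by rewrite fE // gE // hornerM exprD mulf_div.
Qed.

(** U is not stable under conjugation, so the function that is differentiated is
    extended by zero outside U. A polynomial function h which does not vanish at r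
    and vanishes outside U is rational along the curve, so its numerator R excludes
    finitely many t, and t = 0 is not among them. *)
Lemma deriv0_orbit_curve (U : zopen (@rep_coords K A N)) f (P Q : {poly K}) :
  polyfun (@rep_coords K A N) f -> zset U r -> Q.[0] != 0 ->
  (forall t, curve_det.[t] != 0 -> Q.[t] != 0 -> f (orbit_curve t) = P.[t] / Q.[t]) ->
  deriv0 (fun t => ext (to_reg (@rep_coords K A N) U f) (orbit_curve t)) =
    (P^`().[0] * Q.[0] - P.[0] * Q^`().[0]) / Q.[0] ^+ 2.
Proof.
move=> pf_f Ur Q0 fE; have [h [pf_h hr hU]] := zopenP Ur.
have [R [n [R0 hE]]] := polyfun_orbit_curve pf_h.
apply: (@deriv0E _ _ _ _ (R * curve_det)) => // [|t Qt].
  by rewrite hornerM R0 curve_det0 mulr1.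
rewrite hornerM mulf_eq0 negb_or => /andP[Rt Dt].
rewrite ext_to_reg ?fE //; apply: hU.
by rewrite hE // mulf_neq0 // invr_eq0 expf_neq0.
Qed.

End ConjugationCurve.

(** * The action of gl_N on the coordinate functions *)

Section InfinitesimalConjugation.
Variables (K : closedFieldType) (A : algType K) (N : nat).
Local Notation coords := (@rep_coords K A N).
Variable U : zopen coords.
Implicit Types (c : 'M[K]_N) (a b : A).

Lemma lie_fun_cst c (x : K) : lie_fun c (to_reg coords U (fun=> x)) = 0.
Proof.
rewrite -to_reg0; apply: eq_to_reg => r Ur.
rewrite (@deriv0_orbit_curve _ _ _ c r U _ x%:P 1) ?hornerC ?oner_neq0 //.
- by rewrite !derivC horner0 mul0r mulr0 subrr mul0r.
- exact: poly_cst.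
- by move=> t _ _; rewrite !hornerC divr1.
Qed.

Lemma polyfun_coord a i j : polyfun coords (fun r => r a i j).
Proof. by apply: poly_coord; exists a, i, j. Qed.
Hint Resolve polyfun_coord : core.

(** The derivative at 0 of (1 + tc)^-1 (a) (1 + tc). *)
Lemma lie_fun_coord c a i j : lie_fun c (coord U a i j) =
  to_reg coords U (fun r => (r a *m c - c *m r a) i j).
Proof.
apply: eq_to_reg => r Ur.
rewrite (deriv0_orbit_curve (c := c) (P := curve_num c r a i j)
  (Q := curve_det c)) //; first last.
- by move=> t Dt _; rewrite orbit_curveE.
- by rewrite curve_det0 oner_neq0.
have /matrixP/(_ i j) := deriv0_curve_num c r a; rewrite mxE => ->.
rewrite curve_det0 curve_num0 expr1n divr1 mulr1; set d := _^`().[0].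
move: (r a *m c - c *m r a) => B.
by rewrite mxE [X in X + _ - _]mxE mulrC addrC addKr.
Qed.

Lemma mulmx_delta m n p (B : 'M[K]_(m, n)) (k : 'I_n) (l : 'I_p) i j :
  (B *m delta_mx k l) i j = B i k *+ (l == j).
Proof.
rewrite mxE (bigD1 k) //= big1 ?addr0 => [|k' /negPf k'k]; rewrite !mxE.
  by rewrite eqxx eq_sym mulr_natr.
by rewrite k'k mulr0.
Qed.

Lemma delta_mulmx m n p (B : 'M[K]_(n, p)) (k : 'I_m) (l : 'I_n) i j :
  (delta_mx k l *m B) i j = B l j *+ (i == k).
Proof.
rewrite mxE (bigD1 l) //= big1 ?addr0 => [|l' /negPf l'l]; rewrite !mxE.
  by rewrite eqxx andbT mulr_natl.
by rewrite l'l andbF mul0r.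
Qed.

Lemma lie_fun_coord_delta (k l : 'I_N) a i j :
  lie_fun (delta_mx k l) (coord U a i j) =
    coord U a i k *+ (l == j) - coord U a l j *+ (i == k).
Proof.
rewrite lie_fun_coord /coord -!to_regMb -to_regB; try exact: poly_natb.
apply: eq_to_reg => r _; rewrite mxE mulmx_delta; congr (_ + _).
by rewrite mxE delta_mulmx.
Qed.

Lemma coordM a b i j : coord U (a * b) i j = \sum_k coord U a i k * coord U b k j.
Proof.
rewrite -(eq_bigr _ (fun k _ => to_regM U (polyfun_coord a i k) (polyfun_coord b k j))).
rewrite -to_reg_sum => [|k]; last exact: poly_mul.
by apply: eq_to_reg => r _; rewrite rmorphM mxE.
Qed.

Lemma coord1 i j : coord U 1 i j = (i == j)%:R.
Proof.
by rewrite -(to_reg1 coords U) -to_regMb; apply: eq_to_reg => r _; rewrite rmorph1 mxE.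
Qed.

Lemma coord_linear (x : K) a b i j :
  coord U (x *: a + b) i j = to_reg coords U (fun=> x) * coord U a i j + coord U b i j.
Proof.
rewrite -to_regM //; last exact: poly_cst.
rewrite -to_regD //; last by apply: poly_mul => //; exact: poly_cst.
by apply: eq_to_reg => r _; rewrite linearP !mxE.
Qed.

End InfinitesimalConjugation.

(** * The operators attached to the elements of A *)

Section GaugeOperator.
Variables (K : closedFieldType) (A : algType K) (N : nat).
Local Notation coords := (@rep_coords K A N).
Variables (F : equivariant_O_module A N)
  (kappa : 'M[K]_N -> forall U : zopen coords, F U -> F U).
Hypothesis kappaP : infinitesimal_action kappa.
Implicit Types (U V : zopen coords) (m a : A).
Local Notation cst U c := (to_reg coords U (fun=> c)).
Local Notation kappa_E U p := (kappa (delta_mx p.1 p.2) (U := U)).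

Lemma kappaDl c d U (x : F U) : kappa (c + d) x = kappa c x + kappa d x.
Proof.
have := kappa_linear kappaP 1 c d x.
by rewrite scale1r to_reg1 [in RHS]scale1r.
Qed.

Lemma kappa0l U (x : F U) : kappa 0 x = 0.
Proof. by apply: (addrI (kappa 0 x)); rewrite -kappaDl !addr0. Qed.

Lemma kappaBl c d U (x : F U) : kappa (c - d) x = kappa c x - kappa d x.
Proof. by apply: (canRL (addrK _)); rewrite -kappaDl subrK. Qed.

(** For Theta = pEq the sum of the Theta_(i,i) is gauge_op (qp), see [act_thetaE]: the
    sum over i of the coefficients (p)_(i,l) (q)_(k,i) is an entry of a matrix
    product. *)
Definition gauge_op m U (x : F U) : F U :=
  \sum_(p : 'I_N * 'I_N) coord U m p.1 p.2 *: kappa_E U p x.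

Lemma gauge_opDr m U (x y : F U) : gauge_op m (x + y) = gauge_op m x + gauge_op m y.
Proof.
by rewrite -big_split; apply: eq_bigr => p _; rewrite (kappaD kappaP) scalerDr.
Qed.

Lemma gauge_op0r m U : gauge_op m (0 : F U) = 0.
Proof. by apply: (addrI (gauge_op m (0 : F U))); rewrite -gauge_opDr !addr0. Qed.

Lemma gauge_op_sumr m U I (s : seq I) (x : I -> F U) :
  gauge_op m (\sum_(i <- s) x i) = \sum_(i <- s) gauge_op m (x i).
Proof. exact: (big_morph _ (@gauge_opDr m U) (gauge_op0r m U)). Qed.

Lemma gauge_op_leibniz m U (h : structure_sheaf coords U) (x : F U) :
  gauge_op m (h *: x) =
    (\sum_(p : 'I_N * 'I_N) coord U m p.1 p.2 * lie_fun (delta_mx p.1 p.2) h) *: x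
    + h *: gauge_op m x.
Proof.
rewrite scaler_suml scaler_sumr -big_split; apply: eq_bigr => p _.
by rewrite (kappa_leibniz kappaP) scalerDr !scalerA [h * _]mulrC.
Qed.

(** By the Leibniz rule, since gl_N kills the constant functions. *)
Lemma gauge_opZr m c U (x : F U) : gauge_op m (cst U c *: x) = cst U c *: gauge_op m x.
Proof.
rewrite gauge_op_leibniz big1 ?scale0r ?add0r // => p _.
by rewrite lie_fun_cst mulr0.
Qed.

Lemma gauge_op_linear m m' c U (x : F U) :
  gauge_op (c *: m + m') x = cst U c *: gauge_op m x + gauge_op m' x.
Proof.
rewrite scaler_sumr -big_split; apply: eq_bigr => p _.
by rewrite coord_linear scalerDl scalerA.
Qed.

Lemma gauge_opDl m m' U (x : F U) : gauge_op (m + m') x = gauge_op m x + gauge_op m' x.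
Proof. by have := gauge_op_linear m m' 1 x; rewrite scale1r to_reg1 [in RHS]scale1r. Qed.

Lemma gauge_op0l U (x : F U) : gauge_op 0 x = 0.
Proof. by apply: (addrI (gauge_op 0 x)); rewrite -gauge_opDl !addr0. Qed.

Lemma gauge_opBl m m' U (x : F U) : gauge_op (m - m') x = gauge_op m x - gauge_op m' x.
Proof. by apply: (canRL (addrK _)); rewrite -gauge_opDl subrK. Qed.

Lemma gauge_op_suml U I (s : seq I) (m : I -> A) (x : F U) :
  gauge_op (\sum_(i <- s) m i) x = \sum_(i <- s) gauge_op (m i) x.
Proof.
apply: (big_morph (fun m => gauge_op m x)); last exact: gauge_op0l.
by move=> m1 m2; exact: gauge_opDl.
Qed.

Lemma coordB U a m i j : coord U (a - m) i j = coord U a i j - coord U m i j.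
Proof.
have D b b' : coord U (b + b') i j = coord U b i j + coord U b' i j.
  by have := coord_linear U 1 b b' i j; rewrite scale1r to_reg1 mul1r.
by apply: (canRL (addrK _)); rewrite -D subrK.
Qed.

(** e_(k,l) maps the matrix (a) to its commutator with e_(k,l), hence the O-linear
    combination with coefficients (m)_(k,l) maps it to the commutator with (m). *)
Lemma lie_fun_commutator U m a i j :
  \sum_(p : 'I_N * 'I_N) coord U m p.1 p.2 * lie_fun (delta_mx p.1 p.2) (coord U a i j)
    = coord U (a * m - m * a) i j.
Proof.
rewrite -(pair_bigA _ (fun k l => coord U m k l * lie_fun (delta_mx k l) (coord U a i j))).
rewrite /= coordB !coordM.
under eq_bigr => k _ do under eq_bigr => l _ do rewrite lie_fun_coord_delta mulrBr !mulrnAr.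
under eq_bigr => k _ do rewrite sumrB.
rewrite sumrB; congr (_ - _).
  apply: eq_bigr => k _; rewrite (bigD1 j) //= big1 ?addr0 => [|l /negPf ->].
    by rewrite eqxx mulr1n mulrC.
  by rewrite mulr0n.
rewrite (bigD1 i) //= [X in _ + X]big1 ?addr0 => [|k].
  by apply: eq_bigr => l _; rewrite eqxx mulr1n.
by rewrite eq_sym => /negPf ik; apply: big1 => l _; rewrite ik mulr0n.
Qed.

Lemma gauge_op_coord m a U i j (x : F U) :
  gauge_op m (coord U a i j *: x) =
    coord U (a * m - m * a) i j *: x + coord U a i j *: gauge_op m x.
Proof. by rewrite gauge_op_leibniz lie_fun_commutator. Qed.

(** e_(k,l) e_(i,j) is e_(k,j) when l = i, so the sum over l is a matrix product. *)
Lemma gauge_op_mulmx m m' U (x : F U) :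
  \sum_(p : 'I_N * 'I_N) \sum_(q : 'I_N * 'I_N) (coord U m p.1 p.2 * coord U m' q.1 q.2)
     *: kappa (delta_mx p.1 p.2 *m delta_mx q.1 q.2) x = gauge_op (m * m') x.
Proof.
rewrite /gauge_op -(pair_bigA _ (fun k l => \sum_q (coord U m k l * coord U m' q.1 q.2)
     *: kappa (delta_mx k l *m delta_mx q.1 q.2) x)).
rewrite -(pair_bigA _ (fun k j => coord U (m * m') k j *: kappa (delta_mx k j) x)) /=.
apply: eq_bigr => k _.
under [RHS]eq_bigr => j _ do rewrite coordM scaler_suml.
rewrite [RHS]exchange_big; apply: eq_bigr => l _ /=.
rewrite -(pair_bigA _ (fun i j => (coord U m k l * coord U m' i j)
     *: kappa (delta_mx k l *m delta_mx i j) x)) /=.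
rewrite (bigD1 l) //= [X in _ + X]big1 ?addr0 => [|i].
  by apply: eq_bigr => j _; rewrite mul_delta_mx_cond eqxx.
rewrite eq_sym => /negPf li; apply: big1 => j _.
by rewrite mul_delta_mx_cond li mulr0n kappa0l scaler0.
Qed.

(** The derivative hits either the coefficients of gauge_op m' or the section. *)
Lemma gauge_op_comp m m' U (x : F U) :
  gauge_op m (gauge_op m' x) = gauge_op (m' * m - m * m') x +
    \sum_(p : 'I_N * 'I_N) \sum_(q : 'I_N * 'I_N)
      (coord U m p.1 p.2 * coord U m' q.1 q.2) *: kappa_E U p (kappa_E U q x).
Proof.
rewrite gauge_op_sumr.
under eq_bigr => q _ do rewrite gauge_op_coord.
rewrite big_split; congr (_ + _).
rewrite exchange_big; apply: eq_bigr => q _; rewrite scaler_sumr.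
by apply: eq_bigr => p _; rewrite scalerA mulrC.
Qed.

(** The terms in which a coefficient is differentiated contribute twice the commutator
    m' m - m m'; the terms of second order in kappa contribute m m' - m' m once, as
    kappa is a Lie map. *)
Lemma gauge_op_bracket m m' U (x : F U) :
  gauge_op m (gauge_op m' x) - gauge_op m' (gauge_op m x) = gauge_op (m' * m - m * m') x.
Proof.
rewrite !gauge_op_comp [X in _ - (_ + X)]exchange_big opprD addrACA -[X in _ + X]sumrB.
under [X in _ + X]eq_bigr => p _.
  rewrite -sumrB.
  under eq_bigr => q _.
    rewrite [X in _ - X *: _]mulrC -scalerBr -(kappa_lie kappaP) kappaBl scalerBr.
    over.
  rewrite sumrB; over.
rewrite sumrB gauge_op_mulmx.
under [X in _ + (_ - X)]eq_bigr => p _ do under eq_bigr => q _ do rewrite mulrC.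
rewrite [X in _ + (_ - X)]exchange_big gauge_op_mulmx -!gauge_opBl -gauge_opDl.
by rewrite subrK.
Qed.

Lemma gauge_op_restr m U V (h : V `<=` U) (x : F U) :
  restr h (gauge_op m x) = gauge_op m (restr h x).
Proof.
have h0 : restr h (0 : F U) = 0.
  by apply: (addrI (restr h (0 : F U))); rewrite -restrD !addr0.
rewrite (big_morph _ (restrD h) h0); apply: eq_bigr => p _.
rewrite restrZ (kappa_restr kappaP); congr (_ *: _); apply: eq_to_reg => r Vr.
by rewrite ext_to_reg //; [exact: polyfun_coord | exact: (h r)].
Qed.

Lemma act_thetaE (s : seq (A * A)) U (f : 'M[F U]_N) :
  act_theta kappa s f = map_mx (@gauge_op (\sum_(pq <- s) pq.2 * pq.1) U) f.
Proof.
apply/matrixP => u v; rewrite !mxE gauge_op_suml exchange_big.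
apply: eq_bigr => -[p q] _ /=.
rewrite /gauge_op.
rewrite -(pair_bigA _ (fun k l => coord U (q * p) k l *: kappa (delta_mx k l) (f u v))).
rewrite /= exchange_big; apply: eq_bigr => k _.
rewrite exchange_big; apply: eq_bigr => l _ /=.
by rewrite coordM scaler_suml; apply: eq_bigr => i _; rewrite mulrC.
Qed.

End GaugeOperator.

(** * Representations of a semidirect product algebra *)

Section SemidirectRepresentation.
Variables (K : fieldType) (A : algType K) (G : lmodType K).
Variables (act : G -> A -> A) (br : G -> G -> G -> Prop).
Variables (V : lmodType K) (rA : A -> V -> V) (rG : G -> V -> V).

(** The images of the generators satisfy the defining relations of the semidirect
    product, so they extend to a representation on V. *)
Record covariant_pair : Prop := CovariantPair {
  covA_linear : forall a, linear (rA a);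
  covG_linear : forall g, linear (rG g);
  covA_comb : forall c a b v, rA (c *: a + b) v = c *: rA a v + rA b v;
  covG_comb : forall c g h v, rG (c *: g + h) v = c *: rG g v + rG h v;
  covA1 : forall v, rA 1 v = v;
  covAM : forall a b v, rA (a * b) v = rA a (rA b v);
  covG_br : forall g1 g2 g3, br g1 g2 g3 ->
    forall v, rG g1 (rG g2 v) - rG g2 (rG g1 v) = rG g3 v;
  covG_act : forall g a v, rG g (rA a v) - rA a (rG g v) = rA (act g a) v
}.

Fixpoint sd_eval (t : sd_term K A G) (v : V) : V :=
  match t with
  | TA a => rA a v
  | TG g => rG g v
  | TZero => 0
  | TOne => v
  | TAdd x y => sd_eval x v + sd_eval y v
  | TMul x y => sd_eval x (sd_eval y v)
  | TScale c x => c *: sd_eval x v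
  end.

Definition sd_act (x : semidirect act br) : V -> V := sd_eval (repr x).

Hypothesis cov : covariant_pair.

Lemma sd_eval_linear t : linear (sd_eval t).
Proof.
elim: t => [a|g|||x IHx y IHy|x IHx y IHy|d x IHx] c v w /=.
- exact: covA_linear.
- exact: covG_linear.
- by rewrite scaler0 addr0.
- by [].
- by rewrite IHx IHy scalerDr addrACA.
- by rewrite IHy IHx.
- by rewrite IHx scalerDr !scalerA mulrC.
Qed.

Lemma sd_evalD t v w : sd_eval t (v + w) = sd_eval t v + sd_eval t w.
Proof. by have := sd_eval_linear t 1 v w; rewrite !scale1r. Qed.

Lemma sd_evalZ t c v : sd_eval t (c *: v) = c *: sd_eval t v.
Proof.
have t0 : sd_eval t 0 = 0 by apply: (addrI (sd_eval t 0)); rewrite -sd_evalD !addr0.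
by have := sd_eval_linear t c v 0; rewrite !addr0 t0 addr0.
Qed.

Lemma sd_eval_eq s t : sd_eq act br s t -> sd_eval s =1 sd_eval t.
Proof.
elim=> {s t} /=.
- by [].
- by move=> x y _ IH v.
- by move=> x y z _ IH1 _ IH2 v; rewrite IH1.
- by move=> x x' y y' _ IH1 _ IH2 v; rewrite IH1 IH2.
- by move=> x x' y y' _ IH1 _ IH2 v; rewrite IH2 IH1.
- by move=> c x x' _ IH v; rewrite IH.
- by move=> x y z v; rewrite addrA.
- by move=> x y v; rewrite addrC.
- by move=> x v; rewrite add0r.
- by move=> x v; rewrite scaleN1r addNr.
- by [].
- by [].
- by [].
- by [].
- by move=> x y z v; rewrite sd_evalD.
- by move=> c d x v; rewrite scalerA.
- by move=> x v; rewrite scale1r.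
- by move=> c x y v; rewrite scalerDr.
- by move=> c d x v; rewrite scalerDl.
- by [].
- by move=> c x y v; rewrite sd_evalZ.
- exact: covA_comb cov.
- exact: covG_comb cov.
- exact: covA1 cov.
- by move=> g1 g2 g3 h v; rewrite scaleN1r (covG_br cov h).
- by move=> a b v; rewrite (covAM cov).
- by move=> g a v; rewrite scaleN1r (covG_act cov).
Qed.

Lemma sd_act_pi t : sd_act (sd_pi act br t) =1 sd_eval t.
Proof. exact/sd_eval_eq/sd_reprP. Qed.

Lemma sd_actA a : sd_act (sdA act br a) =1 rA a.
Proof. exact: sd_act_pi. Qed.

Lemma sd_actG g : sd_act (sdG act br g) =1 rG g.
Proof. exact: sd_act_pi. Qed.

Lemma sd_act1 : sd_act 1 =1 id.
Proof. exact: sd_act_pi. Qed.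

Lemma sd_actM x y : sd_act (x * y) =1 sd_act x \o sd_act y.
Proof. exact: sd_act_pi. Qed.

Lemma sd_actD x y v : sd_act (x + y) v = sd_act x v + sd_act y v.
Proof. exact: sd_act_pi. Qed.

Lemma sd_actZ c x v : sd_act (c *: x) v = c *: sd_act x v.
Proof. exact: sd_act_pi. Qed.

End SemidirectRepresentation.

(** * The double derivations pEq and the element qp *)

Section InnerDerivation.
Variables (K : fieldType) (A : algType K) (H : hamiltonian_space A).
Implicit Types (P Q : tens A A) (a : A).

(** The element of A which governs the double derivation of p (x) q: it acts on A as the
    inner derivation [sn_act_anchor] and on sections as gauge_op [act_thetaE]. *)
Definition opmul P : A := tlift (fun p q => q * p) P.

Lemma opmul_bilin : bilin (fun p q : A => q * p).
Proof. by split=> [v|u]; [exact: linear_mull|exact: linear_mulr]. Qed.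

Lemma opmul_linear : linear opmul.
Proof. exact/tlift_linear/opmul_bilin. Qed.

Lemma opmulD P Q : opmul (P + Q) = opmul P + opmul Q.
Proof. exact/tliftD/opmul_bilin. Qed.

Lemma opmulN P : opmul (- P) = - opmul P.
Proof. exact/tliftN/opmul_bilin. Qed.

Lemma opmul0 : opmul 0 = 0.
Proof. exact/tlift0/opmul_bilin. Qed.

Lemma opmul_tensor p q : opmul (p ⊗ q) = q * p.
Proof. exact/tlift_tensor/opmul_bilin. Qed.

Lemma mul_bilin : bilin (fun p q : A => p * q).
Proof. by split=> [v|u]; [exact: linear_mulr|exact: linear_mull]. Qed.

(** Multiply the two factors of pEq(a) = aq (x) p - q (x) pa. *)
Lemma sn_act_anchor P a : sn_act (anchor H P) a = a * opmul P - opmul P * a.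
Proof.
rewrite /sn_act; elim/tens_ind: P => [|P Q IHP IHQ|p q].
- by rewrite anchor0 opmul0 mulr0 mul0r subrr /tmul tlift0 //; exact: mul_bilin.
- rewrite anchorD /tmul tliftD; last exact: mul_bilin.
  rewrite -!/(tmul _) IHP IHQ opmulD mulrDr mulrDl opprD.
  by rewrite addrACA.
rewrite anchorE pEqE opmul_tensor /tmul.
rewrite tliftD ?tliftN ?tlift_tensor; try exact: mul_bilin.
by rewrite !mulrA.
Qed.

(** The bracket goes to a commutator, in the order of [gauge_op_bracket]. *)
Lemma opmul_free_bracket P Q :
  opmul (free_bracket P Q) = opmul Q * opmul P - opmul P * opmul Q.
Proof.
elim/tens_ind: P => [|P P' IHP IHP'|p q].
- have -> : free_bracket (0 : tens A A) Q = 0 by apply: tlift0; exact: free_bracket_bilin.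
  by rewrite opmul0 mulr0 mul0r subrr.
- by rewrite free_bracketDl !opmulD IHP IHP' mulrDr mulrDl opprD addrACA.
elim/tens_ind: Q => [|Q Q' IHQ IHQ'|r s].
- have -> : free_bracket (p ⊗ q) (0 : tens A A) = 0.
    by apply: (addrI (free_bracket (p ⊗ q) 0)); rewrite -free_bracketDr !addr0.
  by rewrite opmul0 mulr0 mul0r subrr.
- by rewrite free_bracketDr !opmulD IHQ IHQ' mulrDr mulrDl opprD addrACA.
rewrite free_bracketE /free_br_val !(opmulD, opmulN) !opmul_tensor !mulrA.
by rewrite [LHS](ACl (3*2*(1*4))) /= subrr addr0.
Qed.

Definition tens_of (s : seq (A * A)) : tens A A := \sum_(pq <- s) pq.1 ⊗ pq.2.

Lemma opmul_tens_of s : opmul (tens_of s) = \sum_(pq <- s) pq.2 * pq.1.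
Proof.
rewrite (big_morph _ opmulD opmul0); apply: eq_bigr => pq _.
exact: opmul_tensor.
Qed.

End InnerDerivation.

(** * The K-vector space of matrices of sections *)

Section MatrixSections.
Variables (K : closedFieldType) (A : algType K) (N : nat).
Local Notation coords := (@rep_coords K A N).
Variables (F : equivariant_O_module A N) (U : zopen coords).
Local Notation cst c := (to_reg coords U (fun=> c)).

(** F U is a module over functions; this copy of its matrices carries the structure of
    a vector space over the constants, the one over which the semidirect product is an
    algebra. *)
Definition mx_sections : Type := 'M[F U]_N.
HB.instance Definition _ := GRing.Zmodule.on mx_sections.

Definition mx_scale (c : K) (f : mx_sections) : mx_sections :=
  map_mx (fun y => cst c *: y) f.

Lemma mx_scaleA c d f : mx_scale c (mx_scale d f) = mx_scale (c * d) f.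
Proof.
by apply/matrixP => i j; rewrite !mxE scalerA to_regM //; exact: poly_cst.
Qed.
Lemma mx_scale1 : left_id 1 mx_scale.
Proof. by move=> f; apply/matrixP => i j; rewrite !mxE to_reg1 scale1r. Qed.
Lemma mx_scaleDr : right_distributive mx_scale +%R.
Proof. by move=> c f g; apply/matrixP => i j; rewrite !mxE scalerDr. Qed.
Lemma mx_scaleDl f : {morph mx_scale^~ f : c d / c + d}.
Proof.
move=> c d; apply/matrixP => i j.
by rewrite !mxE to_regD ?scalerDl //; exact: poly_cst.
Qed.
HB.instance Definition _ := GRing.Zmodule_isLmodule.Build K mx_sections
  mx_scaleA mx_scale1 mx_scaleDr mx_scaleDl.

End MatrixSections.

(** * The module structure for a quotient of the free gauge bimodule *)

Section GaugeQuotient.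
Variables (K : closedFieldType) (A : algType K) (H : hamiltonian_space A) (N : nat).
Local Notation coords := (@rep_coords K A N).
Variables (F : equivariant_O_module A N)
  (kappa : 'M[K]_N -> forall U : zopen coords, F U -> F U).
Hypothesis kappaP : infinitesimal_action kappa.
Variables (Gg : lmodType K) (act : Gg -> A -> A) (br : Gg -> Gg -> Gg -> Prop).
(* Both gauge bimodules are quotients of the free bimodule on E: proj is the identity
   for the free one and the anchor for the bimodule of double derivations. *)
Variable proj : tens A A -> Gg.
Hypothesis proj_linear : linear proj.
Hypothesis proj_surj : forall g, exists P, proj P = g.
Hypothesis act_proj : forall P a, act (proj P) a = sn_act (anchor H P) a.
Hypothesis br_proj : forall P Q g, br (proj P) (proj Q) g -> g = proj (free_bracket P Q).

Local Notation theta U P := (map_mx (@gauge_op K A N F kappa (opmul P) U)).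

(* Void for the identity; for the anchor, this is the independence of the action from
   the expression of a double derivation as a sum of terms pEq. *)
Hypothesis theta_proj : forall P Q, proj P = proj Q ->
  forall U (f : 'M[F U]_N), theta U P f = theta U Q f.

Definition lift_gauge (g : Gg) : tens A A := xget 0 [set P | proj P = g].

Lemma lift_gaugeK : cancel lift_gauge proj.
Proof.
move=> g; rewrite /lift_gauge; case: xgetP => [P _ //|].
by have [P eP] := proj_surj g => /(_ P).
Qed.

Definition gauge_act U (g : Gg) (f : mx_sections F U) : mx_sections F U :=
  theta U (lift_gauge g) f.

Lemma gauge_act_proj U P f : gauge_act (U := U) (proj P) f = theta U P f.
Proof. by apply: theta_proj; rewrite lift_gaugeK. Qed.

(** The relations are transported from the free bimodule along proj, where they are
    [gauge_op_bracket] and [gauge_op_coord]. *)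
Lemma gauge_covariant U : covariant_pair act br
  (fun a (f : mx_sections F U) => act_fun a f : mx_sections F U) (@gauge_act U).
Proof.
split=> [a c f g|g c f f'|c a b f|c g h f|f|a b f|g1 g2 g3 br123 f|g a f].
- apply/matrixP => u v; rewrite !mxE scaler_sumr -big_split; apply: eq_bigr => w _.
  by rewrite !mxE scalerDr !scalerA mulrC.
- by apply/matrixP => u v; rewrite !mxE gauge_opDr // gauge_opZr.
- apply/matrixP => u v; rewrite !mxE scaler_sumr -big_split; apply: eq_bigr => w _.
  by rewrite coord_linear scalerDl scalerA.
- rewrite -[g]lift_gaugeK -[h]lift_gaugeK -proj_linear !gauge_act_proj opmul_linear.
  by apply/matrixP => u v; rewrite !mxE gauge_op_linear.
- apply/matrixP => u v; rewrite !mxE (bigD1 u) //= big1 ?addr0 => [|w].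
    by rewrite coord1 eqxx scale1r.
  by rewrite eq_sym coord1 => /negPf ->; rewrite scale0r.
- apply/matrixP => u v; rewrite !mxE.
  under eq_bigr => w _ do rewrite coordM scaler_suml.
  rewrite exchange_big; apply: eq_bigr => w _; rewrite mxE scaler_sumr.
  by apply: eq_bigr => w' _; rewrite scalerA.
- move: br123; rewrite -[g1]lift_gaugeK -[g2]lift_gaugeK => /br_proj ->.
  rewrite !gauge_act_proj opmul_free_bracket.
  by apply/matrixP => u v; rewrite !mxE gauge_op_bracket.
rewrite -[g]lift_gaugeK !gauge_act_proj act_proj sn_act_anchor.
apply/matrixP => u v; rewrite !mxE gauge_op_sumr // -sumrB; apply: eq_bigr => w _.
by rewrite !mxE gauge_op_coord // addrK.
Qed.

(** The action commutes with restriction because the generators do, by induction on a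
    term representing the algebra element. *)
Lemma gauge_quotient_module :
  gauge_action_is_module kappa act br (fun g s => g = proj (tens_of s)).
Proof.
pose m U := sd_act (act := act) (br := br)
  (fun a (f : mx_sections F U) => act_fun a f : mx_sections F U) (@gauge_act U).
exists m; have cov := gauge_covariant.
have mZ U c x (f : mx_sections F U) : m U x (c *: f) = c *: m U x f.
  exact: sd_evalZ.
split=> [|U a f|U g s f ->].
- split=> [U f|U x y f|U x y f|U x f g|U c x f|U c x f|U V h x f].
  + exact: (sd_act1 (cov U) f).
  + exact: (sd_actM (cov U) x y f).
  + exact: (sd_actD (cov U) x y f).
  + exact: (sd_evalD (cov U)).
  + exact: (sd_actZ (cov U) c x f).
  + exact: mZ.
  have h0 : restr h (0 : F U) = 0.
    by apply: (addrI (restr h (0 : F U))); rewrite -restrD !addr0.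
  have rD (f1 f2 : mx_sections F U) : map_mx (restr h) (f1 + f2) =
      map_mx (restr h) f1 + map_mx (restr h) f2.
    by apply/matrixP => i j; rewrite !mxE restrD.
  rewrite /m /sd_act; elim: (repr x) f => [a|g|||s IHs t IHt|s IHs t IHt|c t IHt] f /=.
  + apply/matrixP => u v; rewrite !mxE (big_morph _ (restrD h) h0).
    apply: eq_bigr => w _; rewrite mxE restrZ; congr (_ *: _).
    apply: eq_to_reg => r Vr.
    by rewrite ext_to_reg //; [exact: polyfun_coord | exact: (h r)].
  + by apply/matrixP => u v; rewrite !mxE gauge_op_restr.
  + by apply/matrixP => u v; rewrite !mxE h0.
  + by [].
  + by rewrite rD IHs IHt.
  + by rewrite IHs IHt.
  + rewrite -IHt; apply/matrixP => u v; rewrite !mxE restrZ; congr (_ *: _).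
    apply: eq_to_reg => r Vr.
    by rewrite ext_to_reg //; [exact: poly_cst | exact: (h r)].
- exact: (sd_actA (cov U) a f).
rewrite act_thetaE -opmul_tens_of -gauge_act_proj.
exact: (sd_actG (cov U) (proj (tens_of s)) f).
Qed.

End GaugeQuotient.

Local Close Scope ring_scope.

Theorem theorem1p1 (K : closedFieldType) (charK : [pchar K]%R =i pred0)
  (A : algType K) (fgA : finitely_generated A) (H : hamiltonian_space A)
  (N : nat) (N_gt0 : 0 < N) (F : equivariant_O_module A N)
  (kappa : 'M[K]_N -> forall U : zopen (@rep_coords K A N), F U -> F U)
  (kappaP : infinitesimal_action kappa) :
  free_gauge_module H kappa /\
  (action_well_defined H kappa <-> gauge_module H kappa).
Proof.
split.
  by apply: (gauge_quotient_module kappaP (proj := id)) => // [g|P Q ->]; first exists g.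
split=> [wd|[m [_ _ mG]] s t st U f]; last first.
  (* Both presentations compute the action of one and the same element of G^A. *)
  have hs : pEq_sum H s \in gauge_pred H by apply/asboolP; exists s.
  by rewrite -(mG U (Gauge hs) s) // -(mG U (Gauge hs) t).
pose proj P := Gauge (anchor_gauge H P).
have presE : (fun (T : gauge H) s => gauge_val T = pEq_sum H s) =
    (fun T s => T = proj (tens_of s)).
  apply/funext => T; apply/funext => s; apply/propext; rewrite pEq_sum_anchor.
  by split=> [e|->//]; apply/val_inj.
rewrite /gauge_module presE.
apply: (gauge_quotient_module kappaP).
- move=> c P Q; apply/val_inj/funext => a.
  exact: tlift_linear (pEq_bilin H a) c P Q.
- move=> T; have [s sE] := gauge_presented T; exists (tens_of s).
  by apply/val_inj; rewrite /= -pEq_sum_anchor.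
- by [].
- by move=> P Q T e; apply/val_inj; rewrite /= e sn_bracket_anchor.
move=> P Q /(congr1 val) /= e U f.
have := wd (repr P) (repr Q); rewrite !pEq_sum_anchor -!tens_sum => /(_ e U f).
by rewrite !act_thetaE -!opmul_tens_of /tens_of -!tens_sum.
Qed.
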